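(* Let $b,\sigma:[0,T]\times\mathbb{R}^d\to\mathbb{R}^d$ be continuous and satisfy the assumptions $(H_1)$ and $(H_2)$ stated in the context, let $1-H<\alpha<\alpha_0$, and let $K=\{x\in\mathbb{R}^d:|x|=1\}$ be the unit sphere. Then the following assertions are equivalent: (I) $K$ is viable for the fractional stochastic differential equation $$X_s^{t,x}=x+\int_t^s b(r,X_r^{t,x})dr+\int_t^s\sigma(r,X_r^{t,x})dB^H_r,\quad s\in[t,T].$$ (II) For all $t\in[0,T]$ and all $x\in K$, $\langle x,b(t,x)\rangle=0$ and $\langle x,\sigma(t,x)\rangle=0$.
   Context: Fix $T>0$, $d\ge 1$, $H\in(\frac12,1)$ and a real-valued fractional Brownian motion $B^H=\{B^H_t,t\ge 0\}$ with Hurst parameter $H$ on a complete probability space $(\Omega,\mathcal F,\mathbb P)$. Integrals with respect to $B^H$ are pathwise Riemann-Stieltjes (Young) integrals. $(H_1)$: $\sigma(t,x)$ is differentiable in $x$, and there are constants $\beta,\delta\in(0,1]$, $M_0>0$, and for every $\rho>0$ a constant $M_\rho>0$, such that for all $s,t\in[0,T]$: (i) $|\sigma(t,x)-\sigma(s,y)|\le M_0(|t-s|^\beta+|x-y|)$ for all $x,y\in\mathbb{R}^d$; (ii) $|\nabla_x\sigma(t,y)-\nabla_x\sigma(s,z)|\le M_\rho(|t-s|^\beta+|y-z|^\delta)$ for all $|y|,|z|\le \rho$. Set $\alpha_0=\min\{\frac12,\beta,\frac{\delta}{1+\delta}\}$. $(H_2)$: there are $\mu\in(1-\alpha_0,1]$,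 $L_0>0$, and for every $\rho\ge0$ a constant $L_\rho>0$, such that for all $s,t\in[0,T]$: (i) $|b(t,x)-b(s,y)|\le L_\rho(|t-s|^\mu+|x-y|)$ for all $|x|,|y|\le\rho$; (ii) $|b(t,x)|\le L_0(1+|x|)$ for all $x\in\mathbb{R}^d$. Viability: $K$ is viable for the equation if for every $t\in[0,T]$ and every $x\in K$ there exists a solution $X^{t,x}$, with trajectories a.s. in the space $C^{1-\alpha}([t,T];\mathbb{R}^d)$ of $(1-\alpha)$-Hölder continuous functions, such that a.s. $X_s^{t,x}\in K$ for all $s\in[t,T]$. *)

(* Defs.v *)
From mathcomp Require Import all_boot all_order all_algebra.
From mathcomp Require Import all_classical all_reals all_analysis.
Import Order.TTheory GRing.Theory Num.Theory.
Import numFieldNormedType.Exports.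

Set Implicit Arguments.
Unset Strict Implicit.
Unset Printing Implicit Defensive.

Local Open Scope classical_set_scope.
Local Open Scope ring_scope.

(* The norm [`|_|] that the library puts on matrices is the sup norm, so the
   Euclidean structure is introduced separately. On row vectors [enorm] is the
   Euclidean norm; on Jacobian matrices it is the Frobenius norm. *)
Definition inner (R : realType) (d : nat) (u v : 'rV[R]_d) : R :=
  \sum_(i < d) u ord0 i * v ord0 i.

Definition enorm (R : realType) (m n : nat) (A : 'M[R]_(m, n)) : R :=
  Num.sqrt (\sum_(i < m) \sum_(j < n) A i j ^+ 2).

Definition unit_sphere (R : realType) (d : nat) : set 'rV[R]_d :=
  [set x | enorm x = 1].
Arguments unit_sphere {R d} _.

(* Law of mean [m] and standard deviation [s]. The degenerate case is separate
   because [normal_prob m 0] is the uniform law on [0, 1], not a Dirac mass. *)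
Definition gaussian_law (R : realType) (m s : R) (A : set R) : \bar R :=
  if s == 0 then \d_m A else normal_prob m s A.

Definition gaussian_process (d : measure_display) (Omega : measurableType d)
    (R : realType) (P : probability Omega R) (B : R -> {RV P >-> R}) : Prop :=
  forall (n : nat) (a t : 'I_n -> R), (forall k, 0 <= t k) ->
    exists m s : R, forall A : set R, measurable A ->
      P ((fun w => \sum_(k < n) a k * B (t k) w) @^-1` A) = gaussian_law m s A.

Definition fbm_covariance (R : realType) (H s t : R) : R :=
  2^-1 * (s `^ (2 * H) + t `^ (2 * H) - `|t - s| `^ (2 * H)).

(* The values of [B] at negative times are irrelevant. *)
Definition fractional_brownian_motion (d : measure_display)
    (Omega : measurableType d) (R : realType) (P : probability Omega R)
    (H : R) (B : R -> {RV P >-> R}) : Prop :=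
  [/\ gaussian_process B,
      forall t, 0 <= t -> expectation P (B t) = 0%E,
      forall s t, 0 <= s -> 0 <= t ->
        covariance P (B s) (B t) = (fbm_covariance H s t)%:E
    & \forall w \ae P, {within `[0, +oo[, continuous (fun t => B t w)}].

(* [I] is the Riemann-Stieltjes integral of [f] against [g] over [a, b], as the
   limit of tagged sums when the mesh tends to 0. The points of the partition
   are those of [a :: p], the last one being [b]; [xi k] is the k-th tag. *)
Definition is_RS_integral (R : realType) (f g : R -> R) (a b I : R) : Prop :=
  forall eps : R, 0 < eps -> exists2 del : R, 0 < del &
    forall (p : seq R) (xi : nat -> R), itv_partition a b p ->
      (forall k, (k < size p)%N ->
        [/\ nth b (a :: p) k <= xi k, xi k <= nth b (a :: p) k.+1
          & nth b (a :: p) k.+1 - nth b (a :: p) k < del]) ->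
      `|\sum_(0 <= k < size p)
          f (xi k) * (g (nth b (a :: p) k.+1) - g (nth b (a :: p) k)) - I|
        < eps.

Definition holder_on (R : realType) (d : nat) (gamma t T : R)
    (f : R -> 'rV[R]_d) : Prop :=
  exists C : R, forall u v, u \in `[t, T] -> v \in `[t, T] ->
    enorm (f u - f v) <= C * `|u - v| `^ gamma.

Definition assumption_H1 (R : realType) (d : nat) (T beta delta : R)
    (sigma : R -> 'rV[R]_d -> 'rV[R]_d) : Prop :=
  [/\ forall t x, t \in `[0, T] -> differentiable (sigma t) x,
      exists2 M0 : R, 0 < M0 &
        forall s t x y, s \in `[0, T] -> t \in `[0, T] ->
          enorm (sigma t x - sigma s y)
            <= M0 * (`|t - s| `^ beta + enorm (x - y))
    & forall rho : R, 0 < rho -> exists2 M : R, 0 < M &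
        forall s t y z, s \in `[0, T] -> t \in `[0, T] ->
          enorm y <= rho -> enorm z <= rho ->
          enorm ('J (sigma t) y - 'J (sigma s) z)
            <= M * (`|t - s| `^ beta + enorm (y - z) `^ delta)].

Definition alpha0 (R : realType) (beta delta : R) : R :=
  Num.min 2^-1 (Num.min beta (delta / (1 + delta))).

Definition assumption_H2 (R : realType) (d : nat) (T mu : R)
    (b : R -> 'rV[R]_d -> 'rV[R]_d) : Prop :=
  (forall rho : R, 0 <= rho -> exists2 L : R, 0 < L &
     forall s t x y, s \in `[0, T] -> t \in `[0, T] ->
       enorm x <= rho -> enorm y <= rho ->
       enorm (b t x - b s y) <= L * (`|t - s| `^ mu + enorm (x - y))) /\
  (exists2 L0 : R, 0 < L0 &
     forall t x, t \in `[0, T] -> enorm (b t x) <= L0 * (1 + enorm x)).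

(* [X] is a solution on [t, T] of the equation started from [x] at time [t]:
   a process on [t, T] whose trajectories are almost surely
   (1 - alpha)-Hölder and satisfy the integral equation for all times. *)
Definition is_solution (disp : measure_display) (Omega : measurableType disp)
    (R : realType) (P : probability Omega R) (B : R -> {RV P >-> R})
    (d : nat) (T alpha : R) (b sigma : R -> 'rV[R]_d -> 'rV[R]_d)
    (t : R) (x : 'rV[R]_d) (X : R -> Omega -> 'rV[R]_d) : Prop :=
  [/\ forall s i, s \in `[t, T] ->
        measurable_fun setT (fun w => X s w ord0 i),
      \forall w \ae P, holder_on (1 - alpha) t T (fun s => X s w)
    & \forall w \ae P, forall s, s \in `[t, T] ->
        exists J : 'rV[R]_d,
          (forall i, is_RS_integral (fun r => sigma r (X r w) ord0 i)
                       (fun r => B r w) t s (J ord0 i)) /\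
          X s w = x
            + \row_i \int[lebesgue_measure]_(r in `[t, s]) b r (X r w) ord0 i
            + J].

Definition viable (disp : measure_display) (Omega : measurableType disp)
    (R : realType) (P : probability Omega R) (B : R -> {RV P >-> R})
    (d : nat) (T alpha : R) (b sigma : R -> 'rV[R]_d -> 'rV[R]_d)
    (K : set 'rV[R]_d) : Prop :=
  forall t x, t \in `[0, T] -> K x ->
    exists2 X : R -> Omega -> 'rV[R]_d,
      is_solution B T alpha b sigma t x X &
      \forall w \ae P, forall s, s \in `[t, T] -> K (X s w).

(* Main.v *)
Require Import Defs.
From mathcomp Require Import all_boot all_order all_algebra.
From mathcomp Require Import all_classical all_reals all_analysis.
From mathcomp Require Import measurable_realfun.
From mathcomp Require Import zify ring lra.
Import Order.TTheory GRing.Theory Num.Theory.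
Import numFieldNormedType.Exports.
Set Implicit Arguments.
Unset Strict Implicit.
Unset Printing Implicit Defensive.
Local Open Scope classical_set_scope.
Local Open Scope ring_scope.

(* Put [gamma = 1 - alpha], which lies in (1/2, H): almost every path of [B] is
   [gamma]-Hölder on [0, T] (Gaussian tails, Borel-Cantelli and dyadic chaining).

   (I) => (II). A viable path from [x] at time [t] satisfies
   [X s - x = b (t, x) (s - t) + sigma (t, x) (B s - B t) + O((s - t)^theta)]
   with [theta > 1], by the Young estimate. On the sphere
   [<x, X s - x> = O((s - t)^(2 gamma))], so
   [<x, sigma (t, x)> (B s - B t) + <x, b (t, x)> (s - t) = O((s - t)^theta)].
   As [B] is almost surely not Lipschitz at [t], the coefficient of [B] vanishes,
   and then so does the other one. The time [t = T] follows by continuity.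

   (II) => (I). Run the Euler scheme on dyadic grids and project each step
   radially back to the sphere: the steps being tangent, the projection costs only
   the square of the step. A discrete sewing argument (Davie) bounds
   [X v - X u - b (u, X u) (v - u) - sigma (u, X u) (B v - B u)] by
   [(v - u)^theta] uniformly in the mesh. The scheme is measurable and bounded,
   so it has a measurable cluster point on the dyadic times; the uniform estimate
   extends it to a Hölder path on the sphere, and since [theta > 1] the same
   estimate makes the Riemann-Stieltjes sums converge to the right value. *)

(** * Discrete sewing *)

(** Compactness stands in for convergence of the scheme. A subsequence extracted path by path would
    depend on [w] in an uncontrolled way, so the limit point is built from upper limits only; and
    since the remainder compares two times, grid values must be approached along common levels.
    Sewing is used twice. For Riemann-Stieltjes sums the three-point defect is a plain power of the
    length. For the Euler scheme it also contains a small multiple of the remainder itself, because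
    the coefficients are evaluated along the scheme; this is why the sewing lemma tolerates a factor
    [1 + rho]. The scheme never leaves the sphere, where both fields are bounded and uniformly
    Hölder-Lipschitz: no localisation occurs. The common time exponent [eta] is the minimum of
    [beta], [mu] and [gamma], and [alpha < alpha0] is what makes [eta + gamma > 1]. On the
    probabilistic side, [gaussian_process] provides laws with unspecified parameters [m] and [s],
    while the covariance fixes the variance; the two are compared by inequalities, never
    identified. *)

Lemma powR_le_exp (R : realType) (h a b : R) :
  0 <= h <= 1 -> 0 < a <= b -> h `^ b <= h `^ a.
Proof.
move=> /andP[h0 h1] /andP[a0 ab].
move: h0; rewrite le_eqVlt => /predU1P[<-|h0].
  by rewrite !powR0 ?gt_eqF// (lt_le_trans a0).
by apply: ger_powR => //; rewrite h0.
Qed.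

Lemma powR_le_base (R : realType) (a x y : R) :
  0 <= a -> 0 <= x -> x <= y -> x `^ a <= y `^ a.
Proof.
move=> a0 x0 xy; apply: ge0_ler_powR => //; rewrite nnegrE //.
exact: le_trans xy.
Qed.

Lemma powRDl (R : realType) (h a b : R) : 0 <= h -> 0 < a -> 0 < b ->
  h `^ (a + b) = h `^ a * h `^ b.
Proof.
move=> h0 a0 b0; rewrite powRD//; apply/implyP; rewrite gt_eqF//.
exact: addr_gt0.
Qed.

(** Both halves of [m > 1] are at most [2 m / 3], with equality at [m = 3]. Hence each half [p]
    satisfies [p ^ theta <= p * (2 m / 3) ^ (theta - 1)], and the halves add up to [m]. *)
Lemma powR_half_split (R : realType) (theta : R) : 1 < theta ->
  exists2 kappa : R, 0 < kappa < 1 &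
  forall m : nat, (1 < m)%N ->
    (m./2)%:R `^ theta + (m - m./2)%:R `^ theta <= kappa * m%:R `^ theta.
Proof.
move=> th1; exists ((2 / 3) `^ (theta - 1)).
  rewrite powR_gt0 ?divr_gt0//=.
  apply: (@lt_le_trans _ _ (1 `^ (theta - 1))); last by rewrite powR1.
  by apply: gt0_ltr_powR; rewrite ?subr_gt0// ?nnegrE; lra.
have step (p : nat) (x : R) : p%:R <= 2 / 3 * x -> 0 < x ->
    p%:R `^ theta <= p%:R * ((2 / 3) `^ (theta - 1) * x `^ (theta - 1)).
  move=> px x0; rewrite -powRM ?(ltW x0) ?divr_ge0//.
  have -> : p%:R `^ theta = p%:R * p%:R `^ (theta - 1).
    by rewrite mulr_powRB1 ?ler0n// (lt_trans _ th1).
  by rewrite ler_wpM2l ?ler0n// powR_le_base ?subr_ge0 ?(ltW th1) ?ler0n.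
move=> m m1.
have mx : 0 < m%:R :> R by rewrite ltr0n (ltn_trans _ m1).
have H3 : (3 * (m - m./2) <= 2 * m)%N.
  have := odd_double_half m; case: (odd m) m1 => /=; last by lia.
  by case: (m./2) => [|k]; lia.
have H2 : (3 * m./2 <= 2 * m)%N by lia.
have e1 : ((m./2)%:R : R) <= 2 / 3 * m%:R.
  by move: H2; rewrite -(ler_nat R) !natrM; lra.
have e2 : ((m - m./2)%N%:R : R) <= 2 / 3 * m%:R.
  by move: H3; rewrite -(ler_nat R) !natrM; lra.
apply: (le_trans (lerD (step _ _ e1 mx) (step _ _ e2 mx))).
rewrite -mulrDl -natrD subnKC; last by lia.
rewrite mulrCA -(mulr_powRB1 (ltW mx) (lt_trans ltr01 th1)).
by rewrite !mulrA.
Qed.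

(** Induction on the length by bisection. With [rho = (1 - kappa) / 2] and [c = L * rho], the two
    halves contribute at most [kappa + rho] and the defect [rho], in units of [L] times the full
    power; the total is exactly 1. The value of [rho] is fixed before [c], so that a caller may
    shrink [eps] until its own feedback term is below [rho]. *)
Lemma discrete_sewing (R : realType) (theta : R) : 1 < theta ->
  exists2 rho : R, 0 < rho & forall c : R, 0 <= c -> exists2 L : R, 0 <= L &
  forall (D eps : R) (n : nat) (a : nat -> nat -> R), 0 <= D ->
    (forall j, (j < n)%N -> D <= eps -> a j j.+1 <= c * D `^ theta) ->
    (forall j l k, (j < l < k)%N -> (k <= n)%N -> (k - j)%:R * D <= eps ->
      a j k <= (1 + rho) * a j l + a l k + c * ((k - j)%:R * D) `^ theta) ->
    forall j k, (j < k)%N -> (k <= n)%N -> (k - j)%:R * D <= eps ->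
      a j k <= L * ((k - j)%:R * D) `^ theta.
Proof.
move=> th1; have [kappa /andP[k0 k1] Hk] := @powR_half_split R _ th1.
exists ((1 - kappa) / 2); first by lra.
move=> c c0; exists (2 * c / (1 - kappa)).
  by rewrite divr_ge0 ?mulr_ge0//; lra.
move=> D eps n a D0 a1 aS.
set L := 2 * c / (1 - kappa).
have Lk : L * (1 - kappa) = 2 * c by rewrite /L divfK//; lra.
have L0 : 0 <= L by rewrite divr_ge0 ?mulr_ge0// subr_ge0 ltW.
have cL : c <= L by move: c0 k0 L0 Lk; clear; nra.
suff H m : forall j k, (k - j <= m)%N -> (j < k)%N -> (k <= n)%N ->
    (k - j)%:R * D <= eps -> a j k <= L * ((k - j)%:R * D) `^ theta.
  by move=> j k; apply: (H (k - j)%N).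
elim: m => [j k|m IH j k kjm jk kn kje].
  by rewrite leqn0 subn_eq0 leqNgt => /negbTE ->.
have [kj1|kj1] := leqP (k - j) 1.
  have kE : k = j.+1 by clear -kj1 jk; lia.
  move: kn kje; rewrite kE subSnn mul1r => kn kje.
  apply: (le_trans (a1 _ _ _)) => //.
  by rewrite ler_wpM2r ?powR_ge0.
set l := (j + (k - j)./2)%N.
have [jl lk lj kl] : [/\ j < l, l < k, l - j = (k - j)./2
    & k - l = k - j - (k - j)./2]%N by rewrite /l; clear -kj1 jk; split; lia.
have jlk : (j < l < k)%N by rewrite jl.
have [ljk klk] : (l - j <= k - j /\ k - l <= k - j)%N by clear -jl lk; lia.
have [ljm klm] : (l - j <= m /\ k - l <= m)%N by clear -jl lk kjm; lia.
have ln : (l <= n)%N by rewrite (leq_trans (ltnW lk)).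
have le1 : (l - j)%:R * D <= eps by rewrite (le_trans _ kje)// ler_wpM2r// ler_nat.
have le2 : (k - l)%:R * D <= eps by rewrite (le_trans _ kje)// ler_wpM2r// ler_nat.
have IH1 := IH j l ljm jl ln le1.
have IH2 := IH l k klm lk kn le2.
apply: (le_trans (aS _ _ _ jlk kn kje)).
have := Hk _ kj1.
have pl : (k - j)./2%:R `^ theta <= (k - j)%:R `^ theta :> R.
  by rewrite powR_le_base ?ler0n ?ler_nat ?(ltW (lt_trans ltr01 th1))// -lj.
move: IH1 IH2 pl; rewrite lj kl !powRM ?ler0n//.
have : 0 <= D `^ theta by exact: powR_ge0.
have : 0 <= (k - j)%:R `^ theta :> R by exact: powR_ge0.
set X := (k - j)%:R `^ theta; set A := (k - j)./2%:R `^ theta.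
set B := (k - j - _)%:R `^ theta; set E := D `^ theta => X0 E0 IH1 IH2 pl hk.
have r0 : 0 <= (1 - kappa) / 2 by move: k1; clear; lra.
apply: (le_trans (lerD (lerD (ler_wpM2l _ IH1) IH2) (lexx _))); first by rewrite addr_ge0.
have s : (1 + (1 - kappa) / 2) * A + B + (1 - kappa) / 2 * X <= X.
  have s2 : (1 - kappa) / 2 * A <= (1 - kappa) / 2 * X by rewrite ler_wpM2l.
  by move: s2 hk; clear; lra.
have := ler_wpM2l (mulr_ge0 L0 E0) s.
have -> : c = L * (1 - kappa) / 2 by move: Lk; clear; lra.
by clear; lra.
Qed.

(** * Riemann-Stieltjes integrals of Hölder functions *)

Section RiemannStieltjes.
Context {R : realType}.
Implicit Types (f g I : R -> R) (a b : R).

Lemma mesh_exists (x del : R) : 0 < x -> 0 < del ->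
  exists2 n : nat, (0 < n)%N & x / n%:R < del.
Proof.
move=> x0 d0; exists (Num.truncn (x / del)).+1 => //.
rewrite ltr_pdivrMr ?ltr0n// mulrC -ltr_pdivrMr//.
exact: truncnS_gt.
Qed.

Definition holder_bound (f : R -> R) (a b eta C : R) : Prop :=
  forall u v, a <= u <= b -> a <= v <= b -> `|f u - f v| <= C * `|u - v| `^ eta.

(** The Young estimate: sewing is applied to left-tagged sums on a uniform partition, then the mesh
    tends to 0. The constant depends on the Hölder data only, neither on the functions nor on the
    interval. *)
Lemma RS_integral_bound (eta gamma Cf Cg : R) :
  0 < eta -> 0 < gamma -> 1 < eta + gamma -> 0 <= Cf -> 0 <= Cg ->
  exists2 L : R, 0 <= L & forall f g a b J, a <= b ->
    holder_bound f a b eta Cf -> holder_bound g a b gamma Cg ->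
    is_RS_integral f g a b J ->
    `|J - f a * (g b - g a)| <= L * (b - a) `^ (eta + gamma).
Proof.
move=> eta0 gam0 th1 Cf0 Cg0.
have [rho rho0 /(_ (Cf * Cg) (mulr_ge0 Cf0 Cg0))[L L0 HL]] := @discrete_sewing R _ th1.
exists L => // f g a b J ab hf hg HJ.
apply/ler_addgt0Pr => e e0; have [del del0 Hdel] := HJ e e0.
move: ab; rewrite le_eqVlt => /predU1P[ab|ab].
  (* When [a = b] the empty partition is admissible, its sum is 0, and so [J] is 0. *)
  have := Hdel [::] (fun=> a); rewrite big_geq// => H.
  have /H : itv_partition a b [::] by split=> //=; apply/eqP.
  rewrite ab !subrr mulr0 subr0 sub0r normrN => /(_ _)/ltW/le_trans; apply => //.
  by rewrite lerDr mulr_ge0 ?powR_ge0.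
have [n n0 nd] := @mesh_exists (b - a) del ltac:(by rewrite subr_gt0) del0.
set D := (b - a) / n%:R in nd.
have D0 : 0 < D by rewrite divr_gt0 ?subr_gt0 ?ltr0n.
have nD : n%:R * D = b - a by rewrite mulrC divfK// pnatr_eq0 -lt0n.
clearbody D.
pose tk (k : nat) := a + k%:R * D.
have tkn : tk n = b by rewrite /tk nD addrC subrK.
have tk0 : tk 0%N = a by rewrite /tk mul0r addr0.
have tkB j k : (j <= k)%N -> tk k - tk j = (k - j)%:R * D.
  by move=> jk; rewrite natrB// /tk; clear; ring.
have tk_in k : (k <= n)%N -> a <= tk k <= b.
  move=> kn; apply/andP; split.
    by rewrite -subr_ge0 -tk0 tkB// mulr_ge0 ?ler0n ?(ltW D0).
  by rewrite -subr_ge0 -tkn tkB// mulr_ge0 ?ler0n ?(ltW D0).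
pose p := [seq tk k | k <- iota 1 n].
have sp : size p = n by rewrite size_map size_iota.
have nthp k : (k <= n)%N -> nth b (a :: p) k = tk k.
  case: k => [|k] kn; first by rewrite /= tk0.
  by rewrite /= (nth_map 0%N) ?size_iota// nth_iota// add1n.
have Pp : itv_partition a b p.
  split.
    apply/(pathP b) => i; rewrite sp => ii.
    rewrite nthp ?(ltnW ii)// -[nth b p i]/(nth b (a :: p) i.+1) nthp//.
    by rewrite -subr_gt0 tkB// subSnn mul1r.
  by rewrite (last_nth b) sp nthp// tkn.
pose S j k := \sum_(j <= i < k) f (tk i) * (g (tk i.+1) - g (tk i)).
have H1 : `|S 0%N n - J| < e.
  have := Hdel p tk Pp; rewrite sp => H.
  have -> : S 0%N n = \sum_(0 <= k < n) f (tk k) *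
      (g (nth b (a :: p) k.+1) - g (nth b (a :: p) k)).
    by apply: eq_big_nat => i /andP[_ ii]; rewrite !nthp// ltnW.
  apply: H => k kn; rewrite !nthp ?(ltnW kn)// tkB// subSnn mul1r; split => //.
  by rewrite -subr_ge0 tkB// subSnn mul1r ltW.
(* A single left-tagged term has zero remainder, and the three-point defect is the product of an
   increment of [f] and an increment of [g] over adjacent intervals. *)
have H2 : `|S 0%N n - f (tk 0%N) * (g (tk n) - g (tk 0%N))|
    <= L * ((n - 0)%:R * D) `^ (eta + gamma).
  apply: (HL D (b - a) n (fun j k => `|S j k - f (tk j) * (g (tk k) - g (tk j))|)) => //.
  - exact: ltW.
  - by move=> j jn _; rewrite /S big_nat1 subrr normr0 !mulr_ge0 ?powR_ge0.
  - move=> j l k /andP[jl lk] kn kje.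
    have ln := leq_trans (ltnW lk) kn; have jn := leq_trans (ltnW jl) ln.
    have jk := ltnW (ltn_trans jl lk).
    have -> : S j k - f (tk j) * (g (tk k) - g (tk j)) =
      (S j l - f (tk j) * (g (tk l) - g (tk j))) +
      (S l k - f (tk l) * (g (tk k) - g (tk l))) +
      (f (tk l) - f (tk j)) * (g (tk k) - g (tk l)).
      rewrite /S (big_cat_nat (ltnW jl) (ltnW lk))/=; clear; ring.
    apply: le_trans (ler_normD _ _) _; apply: lerD.
      apply: le_trans (ler_normD _ _) _; rewrite lerD2r.
      by rewrite mulrDl mul1r lerDl mulr_ge0// ltW.
    rewrite normrM powRDl ?mulr_ge0 ?ler0n ?(ltW D0)//.
    rewrite mulrACA ler_pM//.
      apply: (le_trans (hf _ _ (tk_in _ ln) (tk_in _ jn))); rewrite ler_wpM2l//.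
      rewrite tkB ?(ltnW jl)// ger0_norm ?mulr_ge0 ?ler0n ?(ltW D0)//.
      apply: powR_le_base; rewrite ?mulr_ge0 ?ler0n ?(ltW D0) ?(ltW eta0)//.
      by apply: (ler_wpM2r (ltW D0)); rewrite ler_nat; clear -lk; lia.
    apply: (le_trans (hg _ _ (tk_in _ kn) (tk_in _ ln))); rewrite ler_wpM2l//.
    rewrite tkB ?(ltnW lk)// ger0_norm ?mulr_ge0 ?ler0n ?(ltW D0)//.
    apply: powR_le_base; rewrite ?mulr_ge0 ?ler0n ?(ltW D0) ?(ltW gam0)//.
    by apply: (ler_wpM2r (ltW D0)); rewrite ler_nat; clear -jl; lia.
  - by rewrite subn0 nD.
move: H2; rewrite subn0 nD tk0 tkn => H2.
have -> : J - f a * (g b - g a) = (S 0%N n - f a * (g b - g a)) - (S 0%N n - J).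
  by clear; ring.
by apply: le_trans (ler_normB _ _) _; rewrite lerD// ltW.
Qed.

(** A converse to the Young estimate: a function whose increments agree with [f u * (g v - g u)] to
    an order above 1 is an indefinite integral, because the local errors sum to something vanishing
    with the mesh. It yields existence of the integral along the constructed path. *)
Lemma RS_integral_of_expansion (f g I : R -> R) (a b eta gamma Cf Cg C eps : R) :
  0 < eta -> 0 < gamma -> 1 < eta + gamma -> 0 <= Cf -> 0 <= Cg -> 0 <= C ->
  0 < eps -> a <= b ->
  holder_bound f a b eta Cf -> holder_bound g a b gamma Cg ->
  (forall u v, a <= u -> u <= v -> v <= b -> v - u <= eps ->
     `|I v - I u - f u * (g v - g u)| <= C * (v - u) `^ (eta + gamma)) ->
  is_RS_integral f g a b (I b - I a).
Proof.
move=> eta0 gam0 th1 Cf0 Cg0 C0 eps0 ab hf hg HI e e0.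
set theta := eta + gamma in th1 HI.
pose K := C + Cf * Cg + 1.
have K0 : 0 < K by rewrite ltr_wpDl// addr_ge0// mulr_ge0.
(* In [K], [C] pays for the expansion and [Cf * Cg] for moving a tag to the left end. A mesh below
   [x ^ (1 / (theta - 1))] turns [h ^ theta] into at most [x * h], so the total error is at most
   [K * x * (b - a) < e]; the [+ 1] keeps the denominator positive when [a = b]. *)
pose x := e / (K * (b - a + 1)).
have ba1 : 0 < b - a + 1 by rewrite ltr_wpDl// subr_ge0.
have x0 : 0 < x by rewrite divr_gt0// mulr_gt0.
have th0 : 0 < theta - 1 by rewrite subr_gt0.
exists (Num.min eps (x `^ (theta - 1)^-1)).
  by rewrite lt_min eps0 powR_gt0.
move=> p xi Pp Hp.
pose t k := nth b (a :: p) k.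
have tin k : (k <= size p)%N -> a <= t k <= b.
  by move=> kp; rewrite (itv_partition_nth_ge _ Pp)// (itv_partition_nth_le _ Pp).
have t0 : t 0%N = a by [].
have tn : t (size p) = b by rewrite /t (itv_partition_nth_size b Pp).
have -> : I b - I a = \sum_(0 <= k < size p) (I (t k.+1) - I (t k)).
  by rewrite telescope_sumr// t0 tn.
rewrite -sumrB.
have bd k : (0 <= k < size p)%N ->
  `|f (xi k) * (g (t k.+1) - g (t k)) - (I (t k.+1) - I (t k))|
     <= K * x * (t k.+1 - t k).
  move=> /andP[_ kp]; have [l1 l2] := Hp k kp.
  rewrite lt_min -/(t k) -/(t k.+1) in l1 l2 * => /andP[he hx].
  have /andP[a1 a2] := tin k (ltnW kp); have /andP[a3 a4] := tin k.+1 kp.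
  have tt : t k <= t k.+1 by exact: le_trans l1 l2.
  set h := t k.+1 - t k in he hx *.
  have h0 : 0 <= h by rewrite subr_ge0.
  have hth : h `^ theta <= x * h.
    rewrite -(mulr_powRB1 h0 (lt_trans ltr01 th1)) mulrC ler_wpM2r//.
    have -> : x = (x `^ (theta - 1)^-1) `^ (theta - 1).
      by rewrite -powRrM mulVf ?gt_eqF// powRr1// ltW.
    by rewrite powR_le_base// ltW.
  have -> : f (xi k) * (g (t k.+1) - g (t k)) - (I (t k.+1) - I (t k)) =
     (f (xi k) - f (t k)) * (g (t k.+1) - g (t k))
       - (I (t k.+1) - I (t k) - f (t k) * (g (t k.+1) - g (t k))).
    by clear; ring.
  apply: le_trans (ler_normB _ _) _.
  have e1 := HI _ _ a1 tt a4 (ltW he).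
  have e2 : `|(f (xi k) - f (t k)) * (g (t k.+1) - g (t k))| <= Cf * Cg * h `^ theta.
    rewrite normrM /theta powRDl// mulrACA ler_pM//.
      have xin : a <= xi k <= b by rewrite (le_trans a1 l1) (le_trans l2 a4).
      apply: (le_trans (hf _ _ xin (tin k (ltnW kp)))); rewrite ler_wpM2l//.
      rewrite powR_le_base ?(ltW eta0)// ger0_norm ?subr_ge0//.
      by rewrite lerB.
    apply: (le_trans (hg _ _ (tin _ kp) (tin _ (ltnW kp)))).
    by rewrite ger0_norm.
  apply: (le_trans (lerD e2 e1)); rewrite -mulrDl -mulrA.
  apply: ler_pM => //; rewrite ?addr_ge0 ?mulr_ge0 ?powR_ge0//.
  by rewrite /K addrC lerDl.
apply: le_lt_trans (ler_norm_sum _ _ _) _.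
apply: (@le_lt_trans _ _ (\sum_(0 <= k < size p) K * x * (t k.+1 - t k))).
  exact: ler_sum_nat.
rewrite -mulr_sumr telescope_sumr// t0 tn.
have -> : K * x = e / (b - a + 1).
  by rewrite /x; field; rewrite !gt_eqF.
rewrite mulrAC ltr_pdivrMr// ltr_pM2l// ltrDl ltr01//.
Qed.

End RiemannStieltjes.

(** * Euclidean geometry of the sphere *)

Section EuclideanRows.
Context {R : realType} {d : nat}.
Implicit Types (u v w x y : 'rV[R]_d) (a c : R).

Lemma rV_norm_coord v i : `|v ord0 i| <= `|v|.
Proof.
rewrite [leRHS]mx_normrE; apply: le_trans (le_bigmax _ _ (ord0, i)) => /=.
exact: lexx.
Qed.

Lemma rV_norm_le v c : 0 <= c -> (forall i, `|v ord0 i| <= c) -> `|v| <= c.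
Proof.
move=> c0 vc; rewrite [leLHS]mx_normrE; apply/bigmax_leP; split => // -[i j] _ /=.
by rewrite ord1.
Qed.

Lemma innerC u v : inner u v = inner v u.
Proof. by apply: eq_bigr => i _; rewrite mulrC. Qed.

Lemma innerDr u v w : inner u (v + w) = inner u v + inner u w.
Proof. by rewrite /inner -big_split; apply: eq_bigr => i _; rewrite mxE mulrDr. Qed.

Lemma innerZr u a v : inner u (a *: v) = a * inner u v.
Proof. by rewrite /inner mulr_sumr; apply: eq_bigr => i _; rewrite mxE mulrCA. Qed.

Lemma innerNr u v : inner u (- v) = - inner u v.
Proof. by rewrite -scaleN1r innerZr mulN1r. Qed.

Lemma innerBr u v w : inner u (v - w) = inner u v - inner u w.
Proof. by rewrite innerDr innerNr. Qed.

Lemma innerBl u v w : inner (v - w) u = inner v u - inner w u.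
Proof. by rewrite !(innerC _ u) innerBr. Qed.

Lemma inner_ge0 v : 0 <= inner v v.
Proof. by apply: sumr_ge0 => i _; rewrite -expr2 sqr_ge0. Qed.

Lemma inner_bound u v : `|inner u v| <= d%:R * (`|u| * `|v|).
Proof.
apply: le_trans (ler_norm_sum _ _ _) _.
apply: (@le_trans _ _ (\sum_(i < d) `|u| * `|v|)).
  by apply: ler_sum => i _; rewrite normrM ler_pM// rV_norm_coord.
by rewrite sumr_const card_ord mulr_natl.
Qed.

Lemma enormE v : enorm v = Num.sqrt (inner v v).
Proof.
rewrite /enorm /inner big_ord1; congr Num.sqrt.
Qed.

Lemma enorm_ge0 v : 0 <= enorm v.
Proof. exact: sqrtr_ge0. Qed.

Lemma enorm_sqr v : enorm v ^+ 2 = inner v v.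
Proof. by rewrite enormE sqr_sqrtr// inner_ge0. Qed.

Lemma enormZ a v : enorm (a *: v) = `|a| * enorm v.
Proof.
rewrite !enormE innerZr innerC innerZr mulrA -expr2 sqrtrM ?sqr_ge0//.
by rewrite sqrtr_sqr.
Qed.

Lemma norm_le_enorm v : `|v| <= enorm v.
Proof.
apply: rV_norm_le => [|i]; first exact: enorm_ge0.
rewrite -(@ler_pXn2r _ 2)// ?nnegrE ?enorm_ge0//.
rewrite enorm_sqr real_normK ?num_real// /inner (bigD1 i)//= -expr2 lerDl.
by apply: sumr_ge0 => j _; rewrite -expr2 sqr_ge0.
Qed.

Lemma enorm_le_norm v : enorm v <= d%:R * `|v|.
Proof.
rewrite -(@ler_pXn2r _ 2)// ?nnegrE ?enorm_ge0 ?mulr_ge0//.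
rewrite enorm_sqr (le_trans (ler_norm _))// (le_trans (inner_bound _ _))//.
rewrite exprMn -expr2 ler_wpM2r ?sqr_ge0// -natrX ler_nat.
by case: (d) => [|[|k]]//; rewrite expnS expn1 leq_pmulr.
Qed.

Lemma unit_sphereP x : unit_sphere x <-> inner x x = 1.
Proof.
rewrite /unit_sphere /= -enorm_sqr; split=> [->|]; first by rewrite expr1n.
move=> /eqP; rewrite sqrf_eq1 => /orP[/eqP//|/eqP x1].
by have := enorm_ge0 x; rewrite x1 ler0N1.
Qed.

Lemma unit_sphere_norm x : unit_sphere x -> `|x| <= 1.
Proof. by move=> x1; rewrite (le_trans (norm_le_enorm _))// x1. Qed.

Definition sphere_proj y := (enorm y)^-1 *: y.

(** By Pythagoras the squared length of [x + v] is 1 plus that of [v], so it is at least 1 and the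
    projection is well defined. The point moves by [r - 1 <= r ^ 2 - 1], with [r] the length. The
    factor [d] converts to the sup norm. *)
Lemma sphere_proj_tangent x v : unit_sphere x -> inner x v = 0 ->
  unit_sphere (sphere_proj (x + v)) /\
  `|sphere_proj (x + v) - (x + v)| <= d%:R * `|v| ^+ 2.
Proof.
move=> /unit_sphereP x1 xv; set y := x + v.
have y2 : inner y y = 1 + inner v v.
  by rewrite /y innerDr !(innerC (x + v)) !innerDr (innerC v x) x1 xv addr0 add0r.
have y1 : 1 <= enorm y.
  rewrite -(@ler_pXn2r _ 2)// ?nnegrE ?enorm_ge0// expr1n enorm_sqr y2.
  by rewrite lerDl inner_ge0.
have y0 : 0 < enorm y by exact: lt_le_trans y1.
split; first by rewrite /unit_sphere/= /sphere_proj enormZ gtr0_norm ?invr_gt0// mulVf// gt_eqF.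
apply: (le_trans (norm_le_enorm _)).
have -> : sphere_proj y - y = ((enorm y)^-1 - 1) *: y by rewrite scalerBl scale1r.
rewrite enormZ ler0_norm ?subr_le0 ?invf_le1//.
have -> : - ((enorm y)^-1 - 1) * enorm y = enorm y - 1.
  by field; rewrite gt_eqF.
have : enorm y ^+ 2 - 1 <= d%:R * `|v| ^+ 2.
  rewrite enorm_sqr y2 addrC addKr (le_trans (ler_norm _))//.
  by rewrite (le_trans (inner_bound _ _)).
move: y1; set r := enorm y; clear; nra.
Qed.

(** For unit vectors, the inner product of [x] and [y - x] is minus half the squared length of
    [y - x]. *)
Lemma unit_sphere_chord x y : unit_sphere x -> unit_sphere y ->
  `|inner x (y - x)| <= d%:R * `|y - x| ^+ 2.
Proof.
move=> /unit_sphereP x1 /unit_sphereP y1.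
have := inner_bound (y - x) (y - x).
have -> : inner x (y - x) = - (inner (y - x) (y - x) / 2).
  by rewrite innerBl !innerBr (innerC y x) x1 y1; field.
rewrite normrN !ger0_norm ?divr_ge0 ?inner_ge0// expr2.
have := inner_ge0 (y - x); clear; lra.
Qed.

End EuclideanRows.

(** * Projected Euler scheme *)

(* Restricting to [`|t - s| <= 1] lets the time exponents of (H1) and (H2) be
   lowered to a common [eta]. *)
Definition sphere_holder (R : realType) (d : nat) (F : R -> 'rV[R]_d -> 'rV[R]_d)
    (T eta M : R) : Prop :=
  (forall s t x y, 0 <= s <= T -> 0 <= t <= T -> `|t - s| <= 1 ->
     unit_sphere x -> unit_sphere y ->
     `|F t x - F s y| <= M * (`|t - s| `^ eta + `|x - y|)) /\
  (forall t x, 0 <= t <= T -> unit_sphere x -> `|F t x| <= M).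

Section EulerScheme.
Context {R : realType} {d : nat}.
Variables (b sigma : R -> 'rV[R]_d -> 'rV[R]_d).

Definition euler_step (g : R -> R) (u v : R) (y : 'rV[R]_d) : 'rV[R]_d :=
  (v - u) *: b u y + (g v - g u) *: sigma u y.

Fixpoint euler (g : R -> R) (t D : R) (x : 'rV[R]_d) (k : nat) : 'rV[R]_d :=
  if k is k'.+1 then
    let y := euler g t D x k' in
    sphere_proj (y + euler_step g (t + k'%:R * D) (t + k'.+1%:R * D) y)
  else x.

Variables (T eta gamma M : R).
Hypotheses (eta0 : 0 < eta) (etag : eta <= gamma) (gam1 : gamma <= 1).
Hypotheses (th1 : 1 < eta + gamma) (M0 : 0 <= M).
Hypotheses (hb : sphere_holder b T eta M) (hs : sphere_holder sigma T eta M).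

Let gam0 : 0 < gamma := lt_le_trans eta0 etag.

Lemma euler_step_bound (g : R -> R) (Cg u v : R) (y : 'rV[R]_d) :
  holder_bound g 0 T gamma Cg -> 0 <= Cg -> 0 <= u -> u <= v -> v <= T -> v - u <= 1 ->
  unit_sphere y -> `|euler_step g u v y| <= (1 + Cg) * M * (v - u) `^ gamma.
Proof.
move=> hg Cg0 u0 uv vT vu1 y1.
have uT : 0 <= u <= T by rewrite u0 (le_trans uv).
have vT' : 0 <= v <= T by rewrite vT (le_trans u0).
have vu0 : 0 <= v - u by rewrite subr_ge0.
have e1 : v - u <= (v - u) `^ gamma.
  by rewrite -{1}(powRr1 vu0) powR_le_exp ?vu0 ?gam0.
have e2 := hg _ _ vT' uT; rewrite (ger0_norm vu0) in e2.
apply: le_trans (ler_normD _ _) _; rewrite !normrZ (ger0_norm vu0).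
have e3 : (v - u) * `|b u y| <= (v - u) `^ gamma * M by rewrite ler_pM//; exact: hb.2.
have e4 : `|g v - g u| * `|sigma u y| <= Cg * (v - u) `^ gamma * M.
  by rewrite ler_pM//; exact: hs.2.
by move: e3 e4; lra.
Qed.

(** Produces the three-point relation for sewing: the defect is an increment of time or of [g]
    multiplied by the variation of a coefficient between [(u, y)] and [(v, z)]. *)
Lemma euler_step_chasles (g : R -> R) (u v w : R) (y z : 'rV[R]_d) :
  euler_step g u w y = euler_step g u v y + euler_step g v w z
    - ((w - v) *: (b v z - b u y) + (g w - g v) *: (sigma v z - sigma u y)).
Proof.
apply/rowP => i; rewrite /euler_step !mxE; ring.
Qed.

Hypotheses (tb : forall t x, 0 <= t <= T -> unit_sphere x -> inner x (b t x) = 0).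
Hypotheses (ts : forall t x, 0 <= t <= T -> unit_sphere x -> inner x (sigma t x) = 0).

Lemma euler_step_tangent (g : R -> R) (u v : R) (y : 'rV[R]_d) :
  0 <= u <= T -> unit_sphere y -> inner y (euler_step g u v y) = 0.
Proof.
by move=> uT y1; rewrite /euler_step innerDr !innerZr tb// ts// !mulr0 addr0.
Qed.

Lemma euler_sphere (g : R -> R) (t D : R) (x : 'rV[R]_d) (n k : nat) :
  0 <= t -> 0 <= D -> t + n%:R * D <= T -> unit_sphere x -> (k <= n)%N ->
  unit_sphere (euler g t D x k).
Proof.
move=> t0 D0 tT x1; elim: k => [//|k IH kn] /=.
apply: (sphere_proj_tangent (IH (ltnW kn)) _).1.
apply: euler_step_tangent; last exact: IH (ltnW kn).
rewrite addr_ge0 ?mulr_ge0//= (le_trans _ tT)// lerD2l ler_wpM2r//.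
by rewrite ler_nat ltnW.
Qed.

(** Over one step the remainder is the projection error, of order [D ^ (2 gamma)]. Over three points
    the defect involves [E l - E j], which is an Euler step plus the remainder from [j] to [l]; the
    latter is the feedback that [rho] absorbs. Both [eps] and [L] are chosen before the driver, the
    starting point and the mesh. *)
Lemma euler_estimate (Cg : R) : 0 <= Cg ->
  exists eps L : R, [/\ 0 < eps <= 1, 0 <= L &
  forall (g : R -> R) (t D : R) (x : 'rV[R]_d) (n : nat),
    holder_bound g 0 T gamma Cg ->
    0 <= t -> 0 <= D -> t + n%:R * D <= T -> unit_sphere x ->
    forall j k, (j < k)%N -> (k <= n)%N -> (k - j)%:R * D <= eps ->
    `|euler g t D x k - euler g t D x j
        - euler_step g (t + j%:R * D) (t + k%:R * D) (euler g t D x j)|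
      <= L * ((k - j)%:R * D) `^ (eta + gamma)].
Proof.
move=> Cg0.
have [rho rho0 Hrho] := @discrete_sewing R _ th1.
pose K := (1 + Cg) * M.
have K0 : 0 <= K by rewrite mulr_ge0 ?addr_ge0.
have K1 : 0 < K + 1 by rewrite ltr_wpDl.
(* [K * (1 + K)] comes from the variation of the coefficients, [d * K ^ 2] from the projection of a
   step of size [K * D ^ gamma]. *)
pose c := K * (1 + K) + d%:R * K ^+ 2.
have c0 : 0 <= c by rewrite addr_ge0 ?mulr_ge0 ?addr_ge0 ?sqr_ge0 ?ler0n.
have [L L0 HL] := Hrho _ c0.
(* On intervals shorter than [eps] the feedback coefficient [K * h ^ gamma] stays below [rho]. *)
pose eps := Num.min 1 ((rho / (K + 1)) `^ gamma^-1).
have eps0 : 0 < eps by rewrite lt_min ltr01 powR_gt0// divr_gt0.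
have eps1 : eps <= 1 by rewrite ge_min lexx.
have Keps : K * eps `^ gamma <= rho.
  apply: (@le_trans _ _ (K * (rho / (K + 1)))).
    rewrite ler_wpM2l//.
    have -> : rho / (K + 1) = ((rho / (K + 1)) `^ gamma^-1) `^ gamma.
      by rewrite -powRrM mulVf ?gt_eqF// powRr1// divr_ge0// ltW.
    by rewrite powR_le_base ?(ltW gam0) ?(ltW eps0)// /eps ge_min lexx orbT.
  rewrite mulrCA ler_piMr ?(ltW rho0)// ler_pdivrMr// mul1r lerDl//.
exists eps, L; split => //; first by rewrite eps0.
move=> g t D x n hg t0 D0 tT x1.
pose E := euler g t D x; pose tk k := t + k%:R * D.
pose rem j k := E k - E j - euler_step g (tk j) (tk k) (E j).
have tkB j k : (j <= k)%N -> tk k - tk j = (k - j)%:R * D.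
  by move=> jk; rewrite natrB// /tk; ring.
have tk_ge j k : (j <= k)%N -> tk j <= tk k.
  by move=> jk; rewrite -subr_ge0 tkB// mulr_ge0.
have tk_in k : (k <= n)%N -> 0 <= tk k <= T.
  move=> kn; rewrite addr_ge0 ?mulr_ge0//= (le_trans _ tT)//.
  exact: (tk_ge _ _ kn).
have ES k : (k <= n)%N -> unit_sphere (E k) by exact: euler_sphere.
apply: (HL D eps n (fun j k => `|rem j k|)) => //.
  move=> j jn De; have D1 : D <= 1 by exact: le_trans De eps1.
  have /andP[tj0 tj1] := tk_in _ (ltnW jn).
  have Ej := ES _ (ltnW jn).
  set v := euler_step g (tk j) (tk j.+1) (E j).
  have remE : rem j j.+1 = sphere_proj (E j + v) - (E j + v).
    have -> : rem j j.+1 = E j.+1 - E j - v by [].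
    have -> : E j.+1 = sphere_proj (E j + v) by [].
    by rewrite -addrA -opprD.
  have tv : inner (E j) v = 0 by apply: euler_step_tangent => //; exact/tk_in/ltnW.
  rewrite remE; apply: (le_trans (sphere_proj_tangent Ej tv).2).
  have vb : `|v| <= K * D `^ gamma.
    have := @euler_step_bound g Cg (tk j) (tk j.+1) (E j) hg Cg0 tj0 (tk_ge _ _ (leqnSn j)).
    rewrite tkB// subSnn mul1r; apply => //.
    by have /andP[] := tk_in _ jn.
  apply: (@le_trans _ _ (d%:R * (K * D `^ gamma) ^+ 2)).
    apply: ler_wpM2l; rewrite ?ler0n//; apply: lerXn2r; rewrite ?nnegrE//.
    exact: (mulr_ge0 K0 (powR_ge0 _ _)).
  rewrite exprMn mulrA (powRDl D0 eta0 gam0) expr2.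
  have dK0 : 0 <= d%:R * K ^+ 2 by rewrite mulr_ge0 ?sqr_ge0.
  apply: (ler_pM dK0); first by rewrite mulr_ge0 ?powR_ge0.
    by rewrite lerDr mulr_ge0 ?addr_ge0.
  by rewrite ler_wpM2r ?powR_ge0// powR_le_exp ?D0 ?eta0.
move=> j l k /andP[jl lk] kn kje.
have ln := leq_trans (ltnW lk) kn; have jn := leq_trans (ltnW jl) ln.
have jk := ltnW (ltn_trans jl lk).
have remE : rem j k = rem j l + rem l k +
    ((tk k - tk l) *: (b (tk l) (E l) - b (tk j) (E j))
    + (g (tk k) - g (tk l)) *: (sigma (tk l) (E l) - sigma (tk j) (E j))).
  rewrite /rem (euler_step_chasles g (tk j) (tk l) (tk k) (E j) (E l)).
  by apply/rowP => i; rewrite !mxE; ring.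
set h := (k - j)%:R * D in kje *.
have h0 : 0 <= h by rewrite mulr_ge0.
have h1 : h <= 1 by exact: le_trans kje eps1.
have kl0 : 0 <= tk k - tk l by rewrite subr_ge0 tk_ge// ltnW.
have lj0 : 0 <= tk l - tk j by rewrite subr_ge0 tk_ge// ltnW.
have hE : h = (tk k - tk l) + (tk l - tk j).
  by rewrite /h -tkB//; ring.
have klh : tk k - tk l <= h by rewrite hE lerDl.
have ljh : tk l - tk j <= h by rewrite hE lerDr.
have klg : tk k - tk l <= h `^ gamma.
  by rewrite (le_trans klh)// -{1}(powRr1 h0) powR_le_exp ?h0 ?gam0.
have gkl : `|g (tk k) - g (tk l)| <= Cg * h `^ gamma.
  apply: (le_trans (hg _ _ (tk_in _ kn) (tk_in _ ln))).
  by rewrite (ger0_norm kl0) ler_wpM2l// powR_le_base// ltW.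
have Elj : `|E l - E j| <= `|rem j l| + K * h `^ eta.
  have -> : E l - E j = rem j l + euler_step g (tk j) (tk l) (E j) by rewrite /rem subrK.
  apply: le_trans (ler_normD _ _) _; rewrite lerD2l.
  have /andP[tj0 _] := tk_in _ jn; have /andP[_ tl1] := tk_in _ ln.
  apply: (le_trans (@euler_step_bound g Cg (tk j) (tk l) (E j) hg Cg0 tj0 _ tl1 _ (ES _ jn))).
  - by rewrite tk_ge// ltnW.
  - exact: le_trans ljh h1.
  rewrite ler_wpM2l// (@le_trans _ _ (h `^ gamma))// ?powR_le_base ?(ltW gam0)//.
  by rewrite powR_le_exp ?h0 ?eta0.
have field_diff F : sphere_holder F T eta M ->
    `|F (tk l) (E l) - F (tk j) (E j)| <= M * ((1 + K) * h `^ eta + `|rem j l|).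
  move=> [hF _]; have lj1 : `|tk l - tk j| <= 1 by rewrite ger0_norm// (le_trans ljh).
  apply: (le_trans (hF _ _ _ _ (tk_in _ jn) (tk_in _ ln) lj1 (ES _ ln) (ES _ jn))).
  have -> : (1 + K) * h `^ eta + `|rem j l| = h `^ eta + (`|rem j l| + K * h `^ eta).
    by ring.
  rewrite (ger0_norm lj0); apply: (ler_wpM2l M0); apply: lerD => //.
  by rewrite powR_le_base// ltW.
rewrite remE; apply: le_trans (ler_normD _ _) _.
have /andP[tlj _] := tk_in _ jn.
have cross : `|(tk k - tk l) *: (b (tk l) (E l) - b (tk j) (E j))
    + (g (tk k) - g (tk l)) *: (sigma (tk l) (E l) - sigma (tk j) (E j))|
    <= rho * `|rem j l| + c * h `^ (eta + gamma).
  apply: le_trans (ler_normD _ _) _; rewrite !normrZ (ger0_norm kl0).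
  have e1 := ler_pM kl0 (normr_ge0 _) klg (field_diff _ hb).
  have e2 := ler_pM (normr_ge0 _) (normr_ge0 _) gkl (field_diff _ hs).
  apply: (le_trans (lerD e1 e2)).
  have -> : h `^ gamma * (M * ((1 + K) * h `^ eta + `|rem j l|)) +
    Cg * h `^ gamma * (M * ((1 + K) * h `^ eta + `|rem j l|))
    = K * h `^ gamma * `|rem j l| + K * (1 + K) * (h `^ eta * h `^ gamma).
    by rewrite /K; ring.
  rewrite -(powRDl h0 eta0 gam0); apply: lerD.
    rewrite ler_wpM2r// (le_trans _ Keps)// ler_wpM2l// powR_le_base//.
    exact: ltW.
  by rewrite ler_wpM2r ?powR_ge0// /c lerDl mulr_ge0 ?sqr_ge0.
apply: (le_trans (lerD (ler_normD _ _) cross)).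
by lra.
Qed.

End EulerScheme.

(** * Dyadic grids *)

(** The limit is written with [limn_sup], which is defined for every sequence: the limit path is
    then a measurable expression in [w] even where convergence fails. *)
Lemma limn_sup_rate (R : realType) (w : R^nat) (r : nat -> R) (N : nat) :
  (forall m m', (N <= m)%N -> (m <= m')%N -> `|w m' - w m| <= r m) ->
  (forall e, 0 < e -> exists2 m, (N <= m)%N & r m <= e) ->
  forall m, (N <= m)%N -> `|limn_sup w - w m| <= r m.
Proof.
move=> wr r0.
have cw : cauchy (w @ \oo).
  apply/cauchy_exP => e e0.
  have [m Nm rm] := r0 _ (divr_gt0 e0 (ltr0Sn _ 1)).
  exists (w m); exists m => // m' /= mm'.
  rewrite /= -ball_normE /= distrC (le_lt_trans (wr _ _ Nm mm'))// (le_lt_trans rm)//.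
  by rewrite ltr_pdivrMr// ltr_pMr// ltr1n.
have /cvg_ex[l wl] : cvg (w @ \oo) by exact: cauchy_cvg.
have [_ ->] := cvg_limn_inf_sup wl.
move=> m Nm; have cl : (fun k => `|w k - w m|) @ \oo --> `|l - w m|.
  by apply: cvg_norm; apply: cvgB => //; exact: cvg_cst.
apply: (@closed_cvg _ _ _ eventually_filter _ (fun z => z <= r m) _ _ _ cl).
- exact: closed_le.
- by exists m => // k /= mk; exact: wr.
Qed.

Definition dyadic_mesh (R : realType) (t T : R) (n : nat) : R := (T - t) / 2 ^+ n.

Section Dyadic.
Context {R : realType}.
Variables (t T : R).
Hypothesis tT : t <= T.
Local Notation D := (dyadic_mesh t T).

Lemma dyadic_mesh_ge0 n : 0 <= D n.
Proof. by rewrite divr_ge0 ?subr_ge0 ?exprn_ge0. Qed.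

Lemma dyadic_mesh_total n : (2 ^ n)%:R * D n = T - t.
Proof. by rewrite natrX mulrC divfK// expf_neq0. Qed.

Lemma dyadic_mesh_refine m n k : (m <= n)%N ->
  (k * 2 ^ (n - m))%:R * D n = k%:R * D m.
Proof.
move=> mn; rewrite natrM natrX -mulrA; congr (_ * _).
rewrite /dyadic_mesh -{2}(subnK mn) exprD; field.
by rewrite !expf_neq0.
Qed.

Lemma dyadic_mesh_le m n : (m <= n)%N -> D n <= D m.
Proof.
move=> mn; rewrite ler_wpM2l ?subr_ge0// lef_pV2 ?posrE ?exprn_gt0//.
by rewrite ler_weXn2l// ler1n.
Qed.

Lemma dyadic_mesh_small e N : 0 < e -> exists2 n, (N <= n)%N & D n <= e.
Proof.
move=> e0; exists (maxn N (Num.truncn ((T - t) / e)).+1); first exact: leq_maxl.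
apply: (le_trans (dyadic_mesh_le (leq_maxr N _))).
set k := (Num.truncn _).+1.
rewrite ler_pdivrMr ?exprn_gt0// mulrC -ler_pdivrMr//.
apply: (@le_trans _ _ k%:R); first exact/ltW/truncnS_gt.
by rewrite -natrX ler_nat ltnW// ltn_expl.
Qed.

Definition dyadic_floor (m : nat) (s : R) : nat := Num.truncn ((s - t) / D m).

Lemma dyadic_floorP m s : t <= s <= T ->
  [/\ (dyadic_floor m s <= 2 ^ m)%N, t + (dyadic_floor m s)%:R * D m <= s
    & s <= t + (dyadic_floor m s)%:R * D m + D m].
Proof.
move=> /andP[ts sT]; have := dyadic_mesh_ge0 m.
(* If [T = t] the mesh is 0, division by it returns 0, and the index is 0. This case forces the
   non-strict upper bound in the statement. *)
rewrite /dyadic_floor le_eqVlt => /predU1P[D0|D0].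
  have tTe : T = t.
    by apply/eqP; rewrite -subr_eq0 -(dyadic_mesh_total m) -D0 mulr0.
  have -> : s = t by apply/le_anti; rewrite ts andbT -tTe.
  by rewrite -D0 subrr mul0r truncn0 mul0r !addr0.
have s0 : 0 <= (s - t) / D m by rewrite divr_ge0 ?subr_ge0// ltW.
have /andP[f1 f2] := truncn_itv s0.
split.
- rewrite -(ler_nat R) (le_trans f1)// ler_pdivrMr// dyadic_mesh_total.
  by rewrite lerB.
- by rewrite addrC -lerBrDr -ler_pdivlMr.
- move: f2; rewrite ltr_pdivrMr// -natr1 mulrDl mul1r => /ltW.
  by rewrite lerBlDl addrA.
Qed.

Lemma dyadic_floor_le m s s' : s <= s' -> (dyadic_floor m s <= dyadic_floor m s')%N.
Proof.
move=> ss'; apply: le_truncn; rewrite ler_wpM2r ?invr_ge0 ?dyadic_mesh_ge0//.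
by rewrite lerB.
Qed.

Lemma dyadic_floor_refine m m' s : (m <= m')%N -> t <= s <= T ->
  t + (dyadic_floor m s)%:R * D m <= t + (dyadic_floor m' s)%:R * D m'.
Proof.
move=> mm' sT; have [_ le_s _] := dyadic_floorP m sT.
rewrite lerD2l -(dyadic_mesh_refine _ mm').
have := dyadic_mesh_ge0 m'; rewrite le_eqVlt => /predU1P[<-|D0].
  by rewrite !mulr0.
rewrite ler_wpM2r ?(ltW D0)// ler_nat.
have /andP[ts _] := sT.
rewrite /dyadic_floor truncn_ge_nat ?divr_ge0 ?subr_ge0 ?(ltW D0)//.
by rewrite ler_pdivlMr// (dyadic_mesh_refine _ mm') lerBrDl.
Qed.

End Dyadic.

(** * Limits of the Euler scheme *)

Lemma le_of_le_add_mul (R : realType) (a c k : R) : 0 <= k ->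
  (forall e, 0 < e -> a <= c + k * e) -> a <= c.
Proof.
move=> k0 H; apply/ler_addgt0Pr => e e0.
have k1 : 0 < k + 1 by rewrite ltr_wpDl.
apply: (le_trans (H (e / (k + 1)) (divr_gt0 e0 k1))).
by rewrite lerD2l mulrCA ler_piMr ?(ltW e0)// ler_pdivrMr// mul1r lerDl.
Qed.

Lemma unit_sphere_closed (R : realType) (d : nat) (x : 'rV[R]_d) :
  (forall e, 0 < e -> exists2 y, unit_sphere y & `|x - y| <= e) -> unit_sphere x.
Proof.
move=> H; apply/unit_sphereP/eqP; rewrite -subr_eq0 -normr_le0.
apply: (@le_of_le_add_mul _ _ _ (d%:R * 3)); first by rewrite mulr_ge0.
move=> e0 e00; set e := Num.min e0 1.
have e_gt0 : 0 < e by rewrite lt_min e00 ltr01.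
have [y y1 xy] := H e e_gt0; have yn := unit_sphere_norm y1.
move/unit_sphereP in y1.
have -> : inner x x - 1 = inner (x - y) (x - y) + inner y (x - y) *+ 2.
  by rewrite innerBl !innerBr (innerC y x) -y1; ring.
have e1 := inner_bound (x - y) (x - y); have e2 := inner_bound y (x - y).
have le1 : `|x - y| <= 1 by rewrite (le_trans xy)// /e ge_min lexx orbT.
have le0 : `|x - y| <= e0 by rewrite (le_trans xy)// /e ge_min lexx.
apply: le_trans (ler_normD _ _) _; rewrite normrMn add0r.
have f1 : `|x - y| * `|x - y| <= 1 * e0 by rewrite ler_pM.
have f2 : `|y| * `|x - y| <= 1 * e0 by rewrite ler_pM.
have d0 : 0 <= d%:R :> R by [].
have := ler_wpM2l d0 f1; have := ler_wpM2l d0 f2.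
by move: e1 e2; clear; rewrite -mulr_natr; lra.
Qed.

(** Stability of the remainder under a small displacement of both times and both points. It serves
    two limits: from the scheme to its cluster point at fixed times, and from dyadic times to
    arbitrary ones. Times are compared through their power [eta], the largest of the powers involved
    for distances below 1, so that one [e] controls every term. *)
Lemma euler_step_perturb (R : realType) (d : nat)
    (b sigma : R -> 'rV[R]_d -> 'rV[R]_d) (T eta gamma M Cg : R) (g : R -> R)
    (u v u' v' e : R) (y z y' z' : 'rV[R]_d) :
  0 < eta -> eta <= gamma -> gamma <= 1 -> 0 <= M -> 0 <= Cg ->
  sphere_holder b T eta M -> sphere_holder sigma T eta M ->
  holder_bound g 0 T gamma Cg ->
  0 <= u <= T -> 0 <= v <= T -> 0 <= u' <= T -> 0 <= v' <= T ->
  0 <= v' - u' <= 1 -> `|u - u'| <= 1 -> `|v - v'| <= 1 ->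
  `|u - u'| `^ eta <= e -> `|v - v'| `^ eta <= e ->
  unit_sphere y -> unit_sphere y' -> `|y - y'| <= e -> `|z - z'| <= e ->
  `|z - y - euler_step b sigma g u v y|
    <= `|z' - y' - euler_step b sigma g u' v' y'| + (2 + 4 * (1 + Cg) * M) * e.
Proof.
move=> eta0 etag gam1 M0 Cg0 [hb Mb] [hs Ms] hg uT vT uT' vT' /andP[vu0 vu1].
move=> uu1 vv1 uue vve y1 y1' yy zz.
have gam0 : 0 < gamma by exact: lt_le_trans etag.
have e0 : 0 <= e by exact: le_trans (powR_ge0 _ _) uue.
have lin (w w' : R) : `|w - w'| <= 1 -> `|w - w'| `^ eta <= e -> `|w - w'| <= e.
  move=> w1; apply: le_trans; rewrite -[leLHS]powRr1// powR_le_exp ?normr_ge0 ?eta0//.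
  exact: le_trans gam1.
have gin (w w' : R) : 0 <= w <= T -> 0 <= w' <= T ->
    `|w - w'| <= 1 -> `|w - w'| `^ eta <= e -> `|g w - g w'| <= Cg * e.
  move=> wT wT' w1 we; apply: (le_trans (hg _ _ wT wT')); rewrite ler_wpM2l//.
  by apply: le_trans we; rewrite powR_le_exp ?normr_ge0 ?eta0.
have field (F : R -> 'rV[R]_d -> 'rV[R]_d) :
  (forall s t x y, 0 <= s <= T -> 0 <= t <= T -> `|t - s| <= 1 ->
     unit_sphere x -> unit_sphere y ->
     `|F t x - F s y| <= M * (`|t - s| `^ eta + `|x - y|)) ->
  `|F u y - F u' y'| <= M * (2 * e).
  move=> hF; apply: (le_trans (hF _ _ _ _ uT' uT uu1 y1 y1')).
  by rewrite ler_wpM2l//; move: uue yy; clear; lra.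
have -> : z - y - euler_step b sigma g u v y =
  (z' - y' - euler_step b sigma g u' v' y') + ((z - z') - (y - y')) -
  (((v - v') - (u - u')) *: b u y + (v' - u') *: (b u y - b u' y')
  + (((g v - g v') - (g u - g u')) *: sigma u y
    + (g v' - g u') *: (sigma u y - sigma u' y'))).
  by apply/rowP => i; rewrite /euler_step !mxE; clear; ring.
apply: le_trans (ler_normB _ _) _.
apply: (@le_trans _ _ (`|z' - y' - euler_step b sigma g u' v' y'| + 2 * e
   + ((2 * e * M + 1 * (M * (2 * e))) +
   (2 * (Cg * e) * M + Cg * (M * (2 * e)))))); last by clear; lra.
apply: lerD.
  apply: le_trans (ler_normD _ _) _; rewrite lerD2l.
  by apply: le_trans (ler_normB _ _) _; move: yy zz; clear; lra.
apply: le_trans (ler_normD _ _) _.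
apply: lerD; (apply: le_trans (ler_normD _ _) _; rewrite !normrZ; apply: lerD).
- apply: ler_pM => //; last exact: Mb.
  apply: le_trans (ler_normB _ _) _.
  by have := lin _ _ uu1 uue; have := lin _ _ vv1 vve; clear; lra.
- by apply: ler_pM => //; [rewrite ger0_norm|exact: field].
- apply: ler_pM => //; last exact: Ms.
  apply: le_trans (ler_normB _ _) _.
  by have := gin _ _ uT uT' uu1 uue; have := gin _ _ vT vT' vv1 vve; clear; lra.
- apply: ler_pM => //; last exact: field.
  apply: (le_trans (hg _ _ vT' uT')); rewrite ler_piMr// (ger0_norm vu0).
  by have := powR_le_base (ltW gam0) vu0 vu1; rewrite powR1.
Qed.

Lemma powR_small (R : realType) (a e : R) : 0 < a -> 0 < e ->
  exists2 r : R, 0 < r & forall h, 0 <= h <= r -> h `^ a <= e.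
Proof.
move=> a0 e0; exists (e `^ a^-1); first exact: powR_gt0.
move=> h /andP[h0 hr]; apply: (le_trans (powR_le_base (ltW a0) h0 hr)).
by rewrite -powRrM mulVf ?gt_eqF// powRr1// ltW.
Qed.

Section LimitPath.
Context {R : realType} {d : nat}.
Variables (b sigma : R -> 'rV[R]_d -> 'rV[R]_d) (T eta gamma M : R).
Hypotheses (eta0 : 0 < eta) (etag : eta <= gamma) (gam1 : gamma <= 1).
Hypotheses (th1 : 1 < eta + gamma) (M0 : 0 <= M).
Hypotheses (hb : sphere_holder b T eta M) (hs : sphere_holder sigma T eta M).
Hypotheses (tb : forall t x, 0 <= t <= T -> unit_sphere x -> inner x (b t x) = 0).
Hypotheses (ts : forall t x, 0 <= t <= T -> unit_sphere x -> inner x (sigma t x) = 0).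

Variables (t : R) (x : 'rV[R]_d) (g : R -> R) (Cg : R) (Z : nat -> nat -> 'rV[R]_d).
Hypotheses (t0 : 0 <= t) (tT : t <= T) (x1 : unit_sphere x) (Cg0 : 0 <= Cg).
Hypothesis hg : holder_bound g 0 T gamma Cg.

Local Notation D := (dyadic_mesh t T).
Local Notation E n := (euler b sigma g t (D n) x).

(** Two grid points at once, along the same levels [n]: this is the least that lets an inequality
    between two times pass to the limit. *)
Hypothesis accZ : forall m k m' k', (k <= 2 ^ m)%N -> (k' <= 2 ^ m')%N ->
  forall e N, 0 < e -> exists2 n, (N <= n)%N &
    `|Z m k - E n (k * 2 ^ (n - m))| <= e /\
    `|Z m' k' - E n (k' * 2 ^ (n - m'))| <= e.

Let X (s : R) : 'rV[R]_d :=
  \row_i limn_sup (fun m => Z m (dyadic_floor t T m s) ord0 i).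

Let gam0 : 0 < gamma := lt_le_trans eta0 etag.

Let DT n : t + (2 ^ n)%:R * D n <= T.
Proof. by rewrite dyadic_mesh_total addrC subrK. Qed.

Let idx m n k : (k <= 2 ^ m)%N -> (m <= n)%N -> (k * 2 ^ (n - m) <= 2 ^ n)%N.
Proof.
by move=> km mn; rewrite -{2}(subnKC mn) expnD leq_pmul2r ?expn_gt0.
Qed.

Let E_unit n k : (k <= 2 ^ n)%N -> unit_sphere (E n k).
Proof. by apply: (euler_sphere tb ts) => //; exact: dyadic_mesh_ge0. Qed.

Let Z_unit m k : (k <= 2 ^ m)%N -> unit_sphere (Z m k).
Proof.
move=> km; apply: unit_sphere_closed => e e0.
have [n mn [Ze _]] := accZ km km m e0.
by exists (E n (k * 2 ^ (n - m))) => //; apply: E_unit; exact: idx.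
Qed.

Let p_in m k : (k <= 2 ^ m)%N -> 0 <= t + k%:R * D m <= T.
Proof.
move=> km; have D0 := dyadic_mesh_ge0 tT m.
have kD0 : 0 <= k%:R * D m by exact: mulr_ge0.
apply/andP; split; first exact: addr_ge0.
by apply: le_trans (DT m); rewrite lerD2l; apply: ler_wpM2r; rewrite ?ler_nat.
Qed.

(** On a level [n] finer than both grids the two points have integer indices, the scheme satisfies
    the uniform estimate there, and [Z] is within [e] of the scheme at both indices. *)
Let Z_estimate : exists eps L : R, [/\ 0 < eps <= 1, 0 <= L &
  forall m k m' k', (k <= 2 ^ m)%N -> (k' <= 2 ^ m')%N ->
    t + k%:R * D m <= t + k'%:R * D m' ->
    (t + k'%:R * D m') - (t + k%:R * D m) <= eps ->
  `|Z m' k' - Z m k -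
     euler_step b sigma g (t + k%:R * D m) (t + k'%:R * D m') (Z m k)|
   <= L * ((t + k'%:R * D m') - (t + k%:R * D m)) `^ (eta + gamma)].
Proof.
have [eps [L [eps01 L0 HL]]] := euler_estimate eta0 etag gam1 th1 M0 hb hs tb ts Cg0.
exists eps, L; split => //.
move=> m k m' k' km km'; have pT := p_in km; have p'T := p_in km'.
set p := t + _ in pT *; set p' := t + _ in p'T * => pp' pe.
have /andP[eps0 eps1] := eps01.
apply: (@le_of_le_add_mul _ _ _ (2 + 4 * (1 + Cg) * M)).
  by rewrite addr_ge0// !mulr_ge0// addr_ge0.
move=> e e0; have [n + [c c']] := accZ km km' (maxn m m') e0.
rewrite geq_max => /andP[mn m'n].
set j := (k * _)%N in c; set j' := (k' * _)%N in c'.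
have jn : (j <= 2 ^ n)%N by exact: idx.
have j'n : (j' <= 2 ^ n)%N by exact: idx.
have pE : p = t + j%:R * D n by rewrite /p dyadic_mesh_refine.
have p'E : p' = t + j'%:R * D n by rewrite /p' dyadic_mesh_refine.
clearbody p p' j j'.
have z0 (w : R) : `|w - w| <= 1 by rewrite subrr normr0.
have ze (w : R) : `|w - w| `^ eta <= e.
  by rewrite subrr normr0 powR0 ?gt_eqF// ltW.
have pp0 : 0 <= p' - p <= 1 by rewrite subr_ge0 pp' (le_trans pe).
apply: (le_trans (euler_step_perturb eta0 etag gam1 M0 Cg0 hb hs hg
  pT p'T pT p'T pp0 (z0 p) (z0 p') (ze p) (ze p') (Z_unit km) (E_unit jn) c c')).
rewrite lerD2r.
have D0 := dyadic_mesh_ge0 tT n.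
have ppE : p' - p = j'%:R * D n - j%:R * D n by rewrite pE p'E; ring.
have [jj'|j'j] := ltnP j j'.
  have ppE' : p' - p = (j' - j)%:R * D n by rewrite ppE natrB ?mulrBl// ltnW.
  rewrite pE p'E -(_ : p' - p = (t + j'%:R * D n) - (t + j%:R * D n)); last first.
    by rewrite pE p'E.
  rewrite ppE'; apply: (HL _ _ _ _ (2 ^ n)%N) => //.
  by rewrite -ppE'.
(* Sewing requires strictly increasing indices. Otherwise the times coincide, and so do the values:
   either the indices are equal, or the mesh is 0 and the scheme is constant. *)
have ppz : p' - p = 0.
  apply/le_anti; rewrite subr_ge0 pp' andbT ppE subr_le0 ler_wpM2r//.
  by rewrite ler_nat.
have EE : E n j' = E n j.
  have := j'j; rewrite leq_eqVlt => /predU1P[-> //|jj].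
  have Dz : D n = 0.
    apply/eqP; move/eqP: ppz; rewrite ppE -mulrBl mulf_eq0 => /orP[|//].
    by rewrite subr_eq0 eqr_nat ltn_eqF.
  have Ec i : E n i = x.
    elim: i => //= i ->; rewrite /euler_step Dz !mulr0 !addr0 !subrr !scale0r !addr0.
    by rewrite /sphere_proj x1 invr1 scale1r.
  by rewrite !Ec.
rewrite EE /euler_step ppz; have -> : p' = p by apply/eqP; rewrite -subr_eq0 ppz.
by rewrite !subrr !scale0r addr0 subr0 normr0 mulr_ge0 ?powR_ge0.
Qed.

(** The values of [Z] at the dyadic floors of [s] form a Cauchy sequence with a rate uniform in [s],
    and [X s] is their limit. The local estimate is inherited from the floors. *)
Lemma limit_path : (forall s, t <= s <= T -> unit_sphere (X s)) /\ X t = x /\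
  exists eps L : R, [/\ 0 < eps <= 1, 0 <= L &
  forall u v, t <= u -> u <= v -> v <= T -> v - u <= eps ->
  `|X v - X u - euler_step b sigma g u v (X u)| <= L * (v - u) `^ (eta + gamma)].
Proof.
have [eps [L [/andP[eps0 eps1] L0 HZ]]] := Z_estimate.
pose W m s := Z m (dyadic_floor t T m s).
pose fl m s := t + (dyadic_floor t T m s)%:R * D m.
pose C := L + (1 + Cg) * M.
have C0 : 0 <= C by rewrite addr_ge0// mulr_ge0// addr_ge0.
have flP m s : t <= s <= T ->
  [/\ 0 <= fl m s <= T, fl m s <= s, s <= fl m s + D m & unit_sphere (W m s)].
  move=> sT; have [f1 f2 f3] := dyadic_floorP tT m sT.
  by split => //; [exact: p_in | exact: Z_unit].
have [N _ DN] := dyadic_mesh_small tT 0 eps0.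
have Dm m : (N <= m)%N -> D m <= eps.
  by move=> Nm; rewrite (le_trans (dyadic_mesh_le tT Nm)).
(* Floors of one time on two levels are at most [D m] apart, so the remainder and the Euler step
   between them are both of order [D m ^ gamma]. *)
have W_rate s m m' : t <= s <= T -> (N <= m)%N -> (m <= m')%N ->
    `|W m' s - W m s| <= C * D m `^ gamma.
  move=> sT Nm mm'.
  have [a1 a2 a3 a4] := flP m s sT; have [b1 b2 b3 b4] := flP m' s sT.
  have ff : fl m s <= fl m' s by exact: dyadic_floor_refine.
  have fD : fl m' s - fl m s <= D m by move: b2 a3; lra.
  have fe : fl m' s - fl m s <= eps by rewrite (le_trans fD)// Dm.
  have [k1 _ _] := dyadic_floorP tT m sT; have [k1' _ _] := dyadic_floorP tT m' sT.
  have := HZ _ _ _ _ k1 k1' ff fe; rewrite -/(fl m s) -/(fl m' s) -/(W m s) -/(W m' s).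
  have /andP[fm0 _] := a1; have /andP[_ fm'T] := b1.
  have := euler_step_bound eta0 etag gam1 hb hs hg Cg0 fm0 ff fm'T (le_trans fe eps1) a4.
  set v := euler_step _ _ _ _ _ _; set h := fl m' s - fl m s in fD fe *.
  have h0 : 0 <= h by rewrite subr_ge0.
  have hg' : h `^ gamma <= D m `^ gamma by rewrite powR_le_base// ltW.
  have hth : h `^ (eta + gamma) <= h `^ gamma.
    rewrite powR_le_exp ?h0 ?(le_trans fe)// gam0 lerDr ltW//.
  move=> e1 e2; have -> : W m' s - W m s = (W m' s - W m s - v) + v by rewrite subrK.
  apply: le_trans (ler_normD _ _) _; rewrite /C mulrDl; apply: lerD.
    by apply: (le_trans e2); rewrite ler_wpM2l// (le_trans hth).
  by apply: (le_trans e1); rewrite ler_wpM2l// mulr_ge0// addr_ge0.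
have D_small e : 0 < e -> exists2 r, 0 < r & forall m, D m <= r -> C * D m `^ gamma <= e.
  move=> e0; have c1 : 0 < C + 1 by rewrite ltr_wpDl.
  have [r r0 Hr] := powR_small gam0 (divr_gt0 e0 c1).
  exists r => // m Dmr; have := Hr (D m); rewrite dyadic_mesh_ge0// Dmr => /(_ isT).
  rewrite ler_pdivlMr// => H; apply: le_trans H.
  by rewrite mulrC ler_wpM2l ?powR_ge0// lerDl.
have X_rate s m : t <= s <= T -> (N <= m)%N -> `|X s - W m s| <= C * D m `^ gamma.
  move=> sT Nm; apply: rV_norm_le => [|i]; first by rewrite mulr_ge0 ?powR_ge0.
  rewrite !mxE; apply: (@limn_sup_rate _ _ (fun m => C * D m `^ gamma) N) => //.
    move=> k k' Nk kk'; apply: le_trans (W_rate _ _ _ sT Nk kk').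
    by have := rV_norm_coord (W k' s - W k s) i; rewrite !mxE.
  move=> e e0; have [r r0 Hr] := D_small e e0.
  by have [k Nk Dk] := dyadic_mesh_small tT N r0; exists k => //; exact: Hr.
have X_unit s : t <= s <= T -> unit_sphere (X s).
  move=> sT; apply: unit_sphere_closed => e e0.
  have [r r0 Hr] := D_small e e0; have [k Nk Dk] := dyadic_mesh_small tT N r0.
  have [_ _ _ Wu] := flP k s sT.
  by exists (W k s) => //; rewrite (le_trans (X_rate s k sT Nk))// Hr.
split => //; split.
  have Z0 m : Z m 0%N = x.
    apply/eqP; rewrite -subr_eq0 -normr_le0.
    apply: (@le_of_le_add_mul _ _ _ 1) => // e e0.
    have [n _ [+ _]] := accZ (leq0n (2 ^ m)) (leq0n (2 ^ m)) 0%N e0.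
    by rewrite mul0n /= mul1r add0r.
  apply/rowP => i; rewrite mxE.
  under eq_fun do rewrite /dyadic_floor subrr mul0r truncn0 Z0.
  by have [_ ->] := cvg_limn_inf_sup (@cvg_cst _ (x ord0 i) nat \oo _).
(* The floors of [u] and [v] are at most [v - u + D m] apart. Taking [D m] below [v - u] and below
   [eps / 2] bounds this by [2 * (v - u)], whence the power of 2, and by [eps]. *)
exists (eps / 2), (L * 2 `^ (eta + gamma)); split.
- by rewrite divr_gt0//=; move: eps1; lra.
- by rewrite mulr_ge0 ?powR_ge0.
move=> u v tu uv vT uve.
have uT : t <= u <= T by rewrite tu (le_trans uv).
have vT' : t <= v <= T by rewrite vT (le_trans tu).
have := uv; rewrite le_eqVlt => /predU1P[<-|uv'].
  by rewrite /euler_step !subrr !scale0r addr0 subr0 normr0 !mulr_ge0 ?powR_ge0.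
apply: (@le_of_le_add_mul _ _ _ (2 + 4 * (1 + Cg) * M)).
  by rewrite addr_ge0// !mulr_ge0// addr_ge0.
move=> e e0.
have [r1 r10 Hr1] := D_small e e0; have [r2 r20 Hr2] := powR_small eta0 e0.
have eps20 : 0 < eps / 2 by rewrite divr_gt0.
pose r := Num.min (Num.min r1 r2) (Num.min (v - u) (eps / 2)).
have r0 : 0 < r by rewrite !lt_min r10 r20 subr_gt0 uv' eps20.
have [m Nm] := dyadic_mesh_small tT N r0.
rewrite !le_min => /andP[/andP[D1 D2] /andP[Duv De]].
have [a1 a2 a3 a4] := flP m u uT; have [b1 b2 b3 b4] := flP m v vT'.
have ff : fl m u <= fl m v.
  by rewrite lerD2l ler_wpM2r ?dyadic_mesh_ge0// ler_nat dyadic_floor_le.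
have fe : fl m v - fl m u <= eps by move: De uve a3 b2; lra.
have [k1 _ _] := dyadic_floorP tT m uT; have [k1' _ _] := dyadic_floorP tT m vT'.
have HW := HZ _ _ _ _ k1 k1' ff fe.
have close s : t <= s <= T -> `|s - fl m s| <= D m.
  move=> sT; have [_ s2 s3 _] := flP m s sT.
  by rewrite ger0_norm ?subr_ge0// lerBlDl.
have close1 s : t <= s <= T -> `|s - fl m s| <= 1.
  by move=> sT; rewrite (le_trans (close s sT))// (le_trans (Dm m Nm)).
have closee s : t <= s <= T -> `|s - fl m s| `^ eta <= e.
  by move=> sT; rewrite Hr2// normr_ge0 (le_trans (close s sT)).
have Xe s : t <= s <= T -> `|X s - W m s| <= e.
  by move=> sT; rewrite (le_trans (X_rate s m sT Nm))// Hr1.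
have in0 s : t <= s <= T -> 0 <= s <= T.
  by move=> /andP[ts' ->]; rewrite (le_trans t0).
have ff01 : 0 <= fl m v - fl m u <= 1 by rewrite subr_ge0 ff (le_trans fe).
apply: (le_trans (euler_step_perturb eta0 etag gam1 M0 Cg0 hb hs hg
  (in0 _ uT) (in0 _ vT') a1 b1 ff01 (close1 u uT) (close1 v vT')
  (closee u uT) (closee v vT') (X_unit u uT) a4 (Xe u uT) (Xe v vT'))).
rewrite lerD2r; apply: (le_trans HW); rewrite -mulrA ler_wpM2l//.
have vu0 : 0 <= v - u by rewrite subr_ge0.
rewrite -powRM//; apply: powR_le_base.
- exact: ltW (lt_trans ltr01 th1).
- by rewrite subr_ge0.
- by move: a3 b2 Duv; rewrite /fl; lra.
Qed.

End LimitPath.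

(** * From local expansions to the integral equation *)

Lemma holder_bound_continuous (R : realType) (f : R -> R) (a b eta C : R) :
  0 < eta -> 0 <= C -> holder_bound f a b eta C ->
  {within `[a, b], continuous f}.
Proof.
move=> eta0 C0 hf; apply/subspace_continuousP => x /=; rewrite in_itv/= => xab.
apply/cvgrPdist_le => e e0.
have C1 : 0 < C + 1 by rewrite ltr_wpDl.
have [r r0 Hr] := powR_small eta0 (divr_gt0 e0 C1).
rewrite near_withinE; near=> y; rewrite /= in_itv/= => yab.
apply: (le_trans (hf _ _ xab yab)).
have xyr : `|x - y| <= r.
  by near: y; apply: (@cvgr_dist_le _ _ _ (nbhs x) _ id x).
have := Hr `|x - y|; rewrite normr_ge0 xyr => /(_ isT).
rewrite ler_pdivlMr// => H; apply: le_trans H.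
by rewrite mulrC ler_wpM2l ?powR_ge0// lerDl.
Unshelve. all: by end_near.
Qed.

Lemma Rintegral_expansion (R : realType) (phi : R -> R) (t T eta C u v : R) :
  0 < eta -> 0 <= C -> holder_bound phi t T eta C ->
  t <= u -> u <= v -> v <= T ->
  `|\int[lebesgue_measure]_(r in `[t, v]) phi r
    - \int[lebesgue_measure]_(r in `[t, u]) phi r - phi u * (v - u)|
    <= C * (v - u) `^ eta * (v - u).
Proof.
move=> eta0 C0 hphi tu uv vT.
have hv : holder_bound phi t v eta C.
  by move=> x y /andP[x1 x2] /andP[y1 y2]; apply: hphi; apply/andP; split => //; apply: le_trans vT.
have ig : lebesgue_measure.-integrable `[t, v] (EFin \o phi).
  by apply: continuous_compact_integrable; [exact: segment_compact|exact: holder_bound_continuous hv].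
have sub : `]u, v] `<=` `[t, v].
  by move=> x /=; rewrite !in_itv/= => /andP[ux ->]; rewrite (le_trans tu)// ltW.
have ig' : lebesgue_measure.-integrable `]u, v] (EFin \o phi) by exact: integrableS ig.
have igc (c : R) : lebesgue_measure.-integrable `]u, v] (EFin \o cst c).
  apply: (@integrableS _ _ _ lebesgue_measure `[t, v]) => //.
  apply: continuous_compact_integrable; first exact: segment_compact.
  by apply: continuous_subspaceT => x; exact: cvg_cst.
rewrite Rintegral_itvB ?bnd_simp//.
have mu_uv (c : R) : \int[lebesgue_measure]_(r in `]u, v]) cst c r = c * (v - u).
  rewrite Rintegral_cst//= lebesgue_measure_itv/= lte_fin; case: ifP => //= /negbT.
  by rewrite -leNgt => vu; have -> : u = v; [apply/le_anti; rewrite uv | rewrite subrr].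
have igd : lebesgue_measure.-integrable `]u, v] (EFin \o (fun x => phi x - cst (phi u) x)).
  exact: (integrableB _ ig' (igc (phi u))).
rewrite -mu_uv -RintegralB//.
apply: (le_trans (le_normr_Rintegral _ igd)) => //.
rewrite -mu_uv; apply: le_Rintegral => //.
  exact: (integrable_norm igd).
move=> x /=; rewrite in_itv/= => /andP[ux xv].
have utT : t <= u <= T by rewrite tu (le_trans uv).
have xtT : t <= x <= T by rewrite (le_trans tu (ltW ux)) (le_trans xv).
apply: (le_trans (hphi _ _ xtT utT)); rewrite ler_wpM2l// powR_le_base ?(ltW eta0)//.
by rewrite ger0_norm ?subr_ge0 ?(ltW ux)// lerB.
Qed.

(** For times at most 1 apart, the regularity of [F] gives [M * (1 + C)]; for times further apart,
    boundedness gives [2 * M], and the power of the distance is at least 1. *)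
Lemma sphere_field_path_holder (R : realType) (d : nat)
    (F : R -> 'rV[R]_d -> 'rV[R]_d) (X : R -> 'rV[R]_d)
    (t T eta gamma M C : R) (i : 'I_d) :
  0 <= t -> 0 < eta -> eta <= gamma -> 0 <= M -> 0 <= C ->
  sphere_holder F T eta M ->
  (forall s, t <= s <= T -> unit_sphere (X s)) ->
  (forall u v, t <= u <= T -> t <= v <= T -> `|X u - X v| <= C * `|u - v| `^ gamma) ->
  holder_bound (fun r => F r (X r) ord0 i) t T eta (M * (2 + C)).
Proof.
move=> t0 eta0 etag M0 C0 [hF bF] X1 hX u v uT vT.
have in0 s : t <= s <= T -> 0 <= s <= T by move=> /andP[ts ->]; rewrite (le_trans t0).
apply: (@le_trans _ _ `|F u (X u) - F v (X v)|).
  by have := rV_norm_coord (F u (X u) - F v (X v)) i; rewrite !mxE.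
have [uv|uv] := leP `|u - v| 1.
  apply: (le_trans (hF _ _ _ _ (in0 _ vT) (in0 _ uT) uv (X1 _ uT) (X1 _ vT))).
  rewrite -mulrA ler_wpM2l//.
  have e1 := hX _ _ uT vT.
  have e2 : `|u - v| `^ gamma <= `|u - v| `^ eta by rewrite powR_le_exp ?normr_ge0 ?eta0.
  have e3 := ler_wpM2l C0 e2; have e4 := powR_ge0 `|u - v| eta.
  by move: e1 e3 e4; clear; lra.
apply: le_trans (ler_normB _ _) _.
have b1 := bF _ _ (in0 _ uT) (X1 _ uT); have b2 := bF _ _ (in0 _ vT) (X1 _ vT).
have p1 : 1 <= `|u - v| `^ eta.
  by have := powR_le_base (ltW eta0) ler01 (ltW uv); rewrite powR1.
apply: (@le_trans _ _ (M * (2 + C) * 1)).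
  by have := mulr_ge0 M0 C0; move: b1 b2; clear; lra.
by rewrite ler_wpM2l// mulr_ge0// addr_ge0.
Qed.

(** Removing the drift integral from [X] leaves a function with the expansion of a Riemann-Stieltjes
    integral of [sigma] along the path. *)
Lemma path_solution (R : realType) (d : nat)
    (b sigma : R -> 'rV[R]_d -> 'rV[R]_d) (X : R -> 'rV[R]_d)
    (t T eta gamma M Cg eps L : R) (g : R -> R) :
  0 < eta -> eta <= gamma -> gamma <= 1 -> 1 < eta + gamma -> 0 <= M -> 0 <= Cg ->
  sphere_holder b T eta M -> sphere_holder sigma T eta M ->
  holder_bound g 0 T gamma Cg -> 0 <= t ->
  (forall s, t <= s <= T -> unit_sphere (X s)) -> 0 < eps <= 1 -> 0 <= L ->
  (forall u v, t <= u -> u <= v -> v <= T -> v - u <= eps ->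
    `|X v - X u - euler_step b sigma g u v (X u)| <= L * (v - u) `^ (eta + gamma)) ->
  holder_on gamma t T X /\
  forall s, t <= s <= T -> exists J : 'rV[R]_d,
    (forall i, is_RS_integral (fun r => sigma r (X r) ord0 i) g t s (J ord0 i)) /\
    X s = X t + \row_i \int[lebesgue_measure]_(r in `[t, s]) b r (X r) ord0 i + J.
Proof.
move=> eta0 etag gam1 th1 M0 Cg0 hb hs hg t0 X1 /andP[eps0 eps1] L0 HX.
have gam0 : 0 < gamma by exact: lt_le_trans etag.
(* The first part handles intervals shorter than [eps], the second uses that two points of the
   sphere are at most 2 apart. *)
pose C := (L + (1 + Cg) * M) + 2 / eps `^ gamma.
have K0 : 0 <= L + (1 + Cg) * M by rewrite addr_ge0// mulr_ge0// addr_ge0.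
have C0 : 0 <= C by rewrite addr_ge0// divr_ge0 ?powR_ge0.
have in0 s : t <= s <= T -> 0 <= s <= T by move=> /andP[ts ->]; rewrite (le_trans t0).
have hX1 u v : t <= u -> u <= v -> v <= T -> `|X v - X u| <= C * (v - u) `^ gamma.
  move=> tu uv vT; have uT : t <= u <= T by rewrite tu (le_trans uv).
  have vT' : t <= v <= T by rewrite vT (le_trans tu).
  have vu0 : 0 <= v - u by rewrite subr_ge0.
  have [vue|vue] := leP (v - u) eps.
    have vu1 := le_trans vue eps1.
    have e1 := HX u v tu uv vT vue.
    have e2 := euler_step_bound eta0 etag gam1 hb hs hg Cg0 (le_trans t0 tu) uv vT vu1 (X1 u uT).
    have e3 : (v - u) `^ (eta + gamma) <= (v - u) `^ gamma.
      by rewrite powR_le_exp ?vu0// gam0 lerDr ltW.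
    have e4 := ler_wpM2l L0 e3.
    rewrite -[X v - X u](subrK (euler_step b sigma g u v (X u))).
    apply: le_trans (ler_normD _ _) _.
    apply: (@le_trans _ _ ((L + (1 + Cg) * M) * (v - u) `^ gamma)).
      by move: e1 e2 e4; clear; lra.
    by rewrite ler_wpM2r ?powR_ge0// lerDl divr_ge0 ?powR_ge0.
  apply: le_trans (ler_normB _ _) _.
  have := unit_sphere_norm (X1 _ uT); have := unit_sphere_norm (X1 _ vT').
  have e1 : eps `^ gamma <= (v - u) `^ gamma by rewrite powR_le_base ?(ltW gam0) ?(ltW eps0)// ltW.
  have e0 : 0 < eps `^ gamma by exact: powR_gt0.
  have : 2 <= 2 / eps `^ gamma * (v - u) `^ gamma.
    by rewrite mulrAC ler_pdivlMr// ler_wpM2l.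
  have : 0 <= (L + (1 + Cg) * M) * (v - u) `^ gamma by rewrite mulr_ge0 ?powR_ge0.
  by rewrite /C [in leRHS]mulrDl; clear; lra.
have hX u v : t <= u <= T -> t <= v <= T -> `|X u - X v| <= C * `|u - v| `^ gamma.
  move=> /andP[tu uT] /andP[tv vT].
  have [uv|vu] := leP u v.
    by rewrite distrC (distrC u) (ger0_norm (_ : 0 <= v - u)) ?subr_ge0//; exact: hX1.
  by rewrite (ger0_norm (_ : 0 <= u - v)) ?subr_ge0 ?(ltW vu)//; apply: hX1 => //; exact: ltW.
split.
  exists (d%:R * C) => u v; rewrite !in_itv/= => uT vT.
  by apply: (le_trans (enorm_le_norm _)); rewrite -mulrA ler_wpM2l// hX.
move=> s /andP[tS sT].
pose phi i r := b r (X r) ord0 i.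
pose f i r := sigma r (X r) ord0 i.
pose Phi i r := \int[lebesgue_measure]_(q in `[t, r]) phi i q.
pose I i r := X r ord0 i - Phi i r.
have M2 : 0 <= M * (2 + C) by rewrite mulr_ge0// addr_ge0.
have hphi i : holder_bound (phi i) t T eta (M * (2 + C)).
  exact: (@sphere_field_path_holder _ _ _ _ _ _ _ gamma).
have hf i : holder_bound (f i) t T eta (M * (2 + C)).
  exact: (@sphere_field_path_holder _ _ _ _ _ _ _ gamma).
have ins r : t <= r <= s -> t <= r <= T by move=> /andP[-> rs]; rewrite (le_trans rs).
have Phit i : Phi i t = 0.
  by rewrite /Phi set_itv1 Rintegral_set1.
(* With this witness the equation is an identity; what remains is that it is the integral. *)
exists (\row_i (I i s - I i t)); split; last first.
  by apply/rowP => i; rewrite !mxE /I Phit -/(phi i) -/(Phi i s); ring.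
move=> i; rewrite mxE.
apply: (@RS_integral_of_expansion _ _ _ _ _ _ eta gamma (M * (2 + C)) Cg
  (L + M * (2 + C)) eps) => //.
- by rewrite addr_ge0.
- by move=> u v uS vS; apply: hf; exact: ins.
- by move=> u v uS vS; apply: hg; apply: in0; exact: ins.
move=> u v tu uv vs vue.
have vT : v <= T by exact: le_trans sT.
have vu0 : 0 <= v - u by rewrite subr_ge0.
have e1 := HX u v tu uv vT vue.
have e2 := Rintegral_expansion eta0 M2 (hphi i) tu uv vT.
rewrite -/(Phi i v) -/(Phi i u) in e2.
have -> : I i v - I i u - f i u * (g v - g u) =
   (X v - X u - euler_step b sigma g u v (X u)) ord0 i
   - (Phi i v - Phi i u - phi i u * (v - u)).
  by rewrite /I /f /phi /euler_step !mxE; ring.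
apply: le_trans (ler_normB _ _) _; rewrite [leRHS]mulrDl; apply: lerD.
  exact: le_trans (rV_norm_coord _ _) e1.
apply: (le_trans e2); rewrite -mulrA ler_wpM2l// powRDl//.
rewrite ler_wpM2l ?powR_ge0//.
by rewrite -[leLHS](powRr1 vu0) powR_le_exp ?gam0// vu0 (le_trans vue).
Qed.

(** * Measurable selection of a cluster point *)

Lemma limn_sup_cluster (R : realType) (v : R^nat) (C : R) :
  (forall n, `|v n| <= C) ->
  forall e N, 0 < e -> exists2 n, (N <= n)%N & `|limn_sup v - v n| <= e.
Proof.
move=> vC e N e0.
have ub : has_ubound (range v).
  by exists C => _ [n _ <-]; rewrite (le_trans (ler_norm _)).
have lb : has_lbound (range v).
  by exists (- C) => _ [n _ <-]; have := vC n; rewrite ler_norml => /andP[].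
have cv := cvg_sups_inf ub lb.
have -> : limn_sup v = inf (range (sups v)) by exact: cvg_lim cv.
set l := inf _ in cv *.
have e2 : 0 < e / 2 by rewrite divr_gt0.
move/cvgrPdist_le : cv => /(_ _ e2)[M _ HM].
pose N' := maxn N M.
have lN' : `|l - sups v N'| <= e / 2 by apply: HM; rewrite /= leq_maxr.
have hs : has_sup (sdrop v N').
  split; first by exists (v N'), N'; rewrite /=.
  by exists C => _ [n _ <-]; rewrite (le_trans (ler_norm _)).
have [_ [n /= N'n <-] vn] := sup_adherent e2 hs.
have vs : v n <= sups v N' by apply: ub_le_sup; [exact: hs.2|exists n].
exists n; first exact: leq_trans (leq_maxl _ _) N'n.
have -> : l - v n = (l - sups v N') + (sups v N' - v n) by rewrite addrA subrK.
apply: le_trans (ler_normD _ _) _; rewrite (ger0_norm (_ : 0 <= sups v N' - v n)) ?subr_ge0//.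
have {}vn : sups v N' - e / 2 < v n by exact: vn.
by move: vn lN'; clear; lra.
Qed.

Section MeasurableClusterPoint.
Context {disp : measure_display} {Omega : measurableType disp} {R : realType}.
Variable u : nat -> nat -> Omega -> R.
Hypotheses (mu_ : forall q n, measurable_fun setT (u q n)).
Hypotheses (u1 : forall q n w, `|u q n w| <= 1).

(** Separate upper limits for each [q] would be approached along unrelated indices. Coordinates are
    therefore fixed one after the other, each upper limit being restricted to the indices [n] at
    which the earlier coordinates are within [1 / (k + 1)] of their chosen values; then [k] tends to
    infinity. *)
Let near_prefix (s : seq (Omega -> R)) (Q n k : nat) (w : Omega) : bool :=
  all (fun q => `|u q n w - nth (fun=> 0) s q w| <= k.+1%:R^-1) (iota 0 Q).

Let candidate (s : seq (Omega -> R)) (k n : nat) (w : Omega) : R :=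
  if near_prefix s (size s) n k w then u (size s) n w else - 2.

(* [- 2] is out of reach of the [u q n], so a cluster point of the candidates
   above [- 1] is approached along indices at which the prefix [s] is close. *)
Let next (s : seq (Omega -> R)) (w : Omega) : R :=
  limn_sup (fun k => limn_sup (fun n => candidate s k n w)).

Let prefix (Q : nat) : seq (Omega -> R) :=
  iter Q (fun s => rcons s (next s)) [::].

Let Z (q : nat) : Omega -> R := next (prefix q).

Let size_prefix Q : size (prefix Q) = Q.
Proof. by elim: Q => //= Q IH; rewrite size_rcons IH. Qed.

Let nth_prefix Q q : (q < Q)%N -> nth (fun=> 0) (prefix Q) q = Z q.
Proof.
elim: Q => // Q IH; rewrite ltnS leq_eqVlt => /predU1P[->|qQ] /=.
  by rewrite nth_rcons size_prefix ltnn eqxx.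
by rewrite nth_rcons size_prefix qQ IH.
Qed.

Let candidate_bound s k n w : `|candidate s k n w| <= 2.
Proof.
rewrite /candidate; case: ifP => _; last by rewrite normrN ger0_norm.
by rewrite (le_trans (u1 _ _ _))// ler1n.
Qed.

Let limn_sup_bound (v : R^nat) (C : R) : (forall n, `|v n| <= C) -> `|limn_sup v| <= C.
Proof.
move=> vC; apply/ler_addgt0Pr => e e0.
have [n _ ve] := limn_sup_cluster vC 0%N e0.
rewrite -[limn_sup v](subrK (v n)) (le_trans (ler_normD _ _))//.
by rewrite addrC lerD.
Qed.

Let bounded_measurable_limn_sup (h : nat -> Omega -> R) (C : R) :
  (forall n w, `|h n w| <= C) -> (forall n, measurable_fun setT (h n)) ->
  measurable_fun setT (fun w => limn_sup (fun n => h n w)).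
Proof.
move=> hC mh; apply: measurable_fun_limn_sup => // w _.
  by exists C => _ [n _ <-]; rewrite (le_trans (ler_norm _)).
by exists (- C) => _ [n _ <-]; have := hC n w; rewrite ler_norml => /andP[].
Qed.

Let measurable_near_prefix (s : seq (Omega -> R)) Q n k : (forall q, measurable_fun setT (nth (fun=> 0) s q)) ->
  measurable_fun setT (near_prefix s Q n k).
Proof.
move=> ms; rewrite /near_prefix; move: 0%N => a.
elim: Q a => [|Q IH] a /=; first exact: measurable_cst.
apply: measurable_and => //.
apply: measurable_fun_ler => //.
by apply: measurableT_comp => //; exact: measurable_funB.
Qed.

Let measurable_next (s : seq (Omega -> R)) : (forall q, measurable_fun setT (nth (fun=> 0) s q)) ->
  measurable_fun setT (next s).
Proof.
move=> ms; apply: (bounded_measurable_limn_sup (C := 2)).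
  by move=> k w; apply: limn_sup_bound.
move=> k; apply: (bounded_measurable_limn_sup (C := 2)) => //.
by move=> n; apply: measurable_fun_ifT => //; exact: measurable_near_prefix.
Qed.

Let measurable_prefix Q q : measurable_fun setT (nth (fun=> 0) (prefix Q) q).
Proof.
elim: Q q => [|Q IH] q /=; first by rewrite nth_nil.
rewrite nth_rcons; case: ifP => // _; case: ifP => // _.
exact: measurable_next.
Qed.

Let Z_cluster w Q e N : 0 < e ->
  exists2 n, (N <= n)%N & forall q, (q < Q)%N -> `|Z q w - u q n w| <= e.
Proof.
elim: Q e N => [|Q IH] e N e0; first by exists N.
pose l k := limn_sup (fun n => candidate (prefix Q) k n w).
(* By induction the earlier coordinates are close at arbitrarily large [n], where the candidate is a
   genuine value of [u], at least [- 1]. *)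
have lb k : - 1 <= l k.
  have cB n := candidate_bound (prefix Q) k n w.
  have ub : has_ubound (range (fun n => candidate (prefix Q) k n w)).
    by exists 2 => _ [n _ <-]; rewrite (le_trans (ler_norm _)).
  have lb : has_lbound (range (fun n => candidate (prefix Q) k n w)).
    by exists (- 2) => _ [n _ <-]; have := cB n; rewrite ler_norml => /andP[].
  have -> : l k = inf (range (sups (fun n => candidate (prefix Q) k n w))).
    exact: cvg_lim (cvg_sups_inf ub lb).
  apply: lb_le_inf; first by eexists; exists 0%N.
  move=> _ [m _ <-].
  have k0 : 0 < k.+1%:R^-1 :> R by rewrite invr_gt0.
  have [n mn Hn] := IH _ m k0.
  have cn : candidate (prefix Q) k n w = u Q n w.
    rewrite /candidate size_prefix ifT//; apply/allP => q; rewrite mem_iota => /andP[_ qQ].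
    by rewrite nth_prefix// distrC; exact: Hn.
  apply: (@le_trans _ _ (candidate (prefix Q) k n w)).
    by rewrite cn; have := u1 Q n w; rewrite ler_norml => /andP[].
  apply: ub_le_sup; last by exists n.
  by exists 2 => _ [j _ <-]; rewrite (le_trans (ler_norm _)).
have lB k : `|l k| <= 2 by apply: limn_sup_bound.
have e2 : 0 < e / 2 by rewrite divr_gt0.
have [k0 k00 k0e] := mesh_exists ltr01 e0.
have [k kk0 lk] := limn_sup_cluster lB k0 e2.
(* A candidate within [1 / 2] of [l k >= - 1] cannot be [- 2], so the index found has a close
   prefix. *)
have r0 : 0 < Num.min (e / 2) 2^-1 by rewrite lt_min e2 invr_gt0 ltr0n.
have [n Nn ln] := limn_sup_cluster (fun n => candidate_bound (prefix Q) k n w) N r0.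
move: ln; rewrite -/(l k) le_min => /andP[ln1 ln2].
have nearn : near_prefix (prefix Q) Q n k w.
  have := lb k; move: ln2; rewrite /candidate size_prefix; case: ifP => // _.
  by rewrite ler_norml => /andP[_]; lra.
exists n => // q; rewrite ltnS leq_eqVlt => /predU1P[->|qQ].
  move: ln1; rewrite /candidate size_prefix nearn => ln1.
  have -> : Z Q w - u Q n w = (Z Q w - l k) + (l k - u Q n w) by rewrite addrA subrK.
  by apply: le_trans (ler_normD _ _) _; move: lk ln1; rewrite -/(Z Q w); lra.
move/allP: nearn => /(_ q); rewrite mem_iota qQ => /(_ isT).
rewrite nth_prefix// distrC => /le_trans; apply.
apply: le_trans (ltW k0e); rewrite div1r.
by rewrite lef_pV2 ?posrE ?ltr0n// ler_nat ltnW.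
Qed.

(** A measurable substitute for diagonal extraction: for each [w], the family [z] is a cluster point
    in the product topology, reached without choosing a subsequence. *)
Lemma measurable_cluster_point : exists2 z : nat -> Omega -> R,
  (forall q, measurable_fun setT (z q)) &
  forall w Q (e : R) N, 0 < e ->
    exists2 n, (N <= n)%N & forall q, (q < Q)%N -> `|z q w - u q n w| <= e.
Proof.
exists Z => [q|]; last by move=> w Q e N e0; exact: Z_cluster.
by apply: measurable_next => q'; exact: measurable_prefix.
Qed.

End MeasurableClusterPoint.

(** * Measurability of the scheme *)

Lemma rV_rat_dense (R : realType) (d : nat) (x : 'rV[R]_d) (e : R) : 0 < e ->
  exists q : 'rV[rat]_d, forall i, `|x ord0 i - ratr (q ord0 i)| < e.
Proof.
move=> e0.
have H (i : 'I_d) : {q : rat | `|x ord0 i - ratr q| < e}.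
  apply: cid.
  have [q] : exists q : rat, ratr q \in `](x ord0 i - e), (x ord0 i + e)[.
    by apply: rat_in_itvoo; rewrite ltrBlDr -addrA ltrDl addr_gt0.
  rewrite in_itv/= => /andP[q1 q2]; exists q.
  by rewrite ltr_norml; apply/andP; split; lra.
exists (\row_i projT1 (H i)) => i; rewrite mxE; exact: projT2 (H i).
Qed.

(* Preimages of open sets are countable unions of rational boxes. *)
Lemma measurable_comp_rV (disp : measure_display) (Omega : measurableType disp)
    (R : realType) (d : nat) (F : 'rV[R]_d -> R) (X : Omega -> 'rV[R]_d) :
  (forall x e, 0 < e -> exists2 r : R, 0 < r &
     forall y, `|x - y| <= r -> `|F x - F y| < e) ->
  (forall i, measurable_fun setT (fun w => X w ord0 i)) ->
  measurable_fun setT (fun w => F (X w)).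
Proof.
move=> cF mX; apply: (measurability _ (RGenOInfty.measurableE R)).
move=> /= _ [_ [a ->] <-]; rewrite setTI.
pose box (p : 'rV[rat]_d * nat) : set Omega :=
  \bigcap_(i in [set: 'I_d]) [set w | `|X w ord0 i - ratr (p.1 ord0 i)| < p.2.+1%:R^-1].
pose good (p : 'rV[rat]_d * nat) : Prop := forall y : 'rV[R]_d,
  (forall i, `|y ord0 i - ratr (p.1 ord0 i)| < p.2.+1%:R^-1) -> a < F y.
have -> : (fun w => F (X w)) @^-1` `]a, +oo[ =
    \bigcup_p (if `[< good p >] then box p else set0).
  apply/seteqP; split => w /=; last first.
    move=> [p _]; case: ifPn => // /asboolP gp bw.
    by rewrite in_itv/= andbT; apply: gp => i; exact: bw.
  rewrite in_itv/= andbT -subr_gt0 => aF.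
  have [r r0 Hr] := cF (X w) _ aF.
  have [n n0 nr] := mesh_exists (ltr0Sn R 1) r0.
  have n1 : 0 < n.+1%:R^-1 :> R by rewrite invr_gt0.
  have nr' : n.+1%:R^-1 * 2 <= r.
    rewrite mulrC (le_trans _ (ltW nr))// ler_wpM2l// lef_pV2 ?posrE ?ltr0n//.
    by rewrite ler_nat.
  have [q Hq] := rV_rat_dense (X w) n1.
  exists (q, n) => //; rewrite ifT; first by move=> i _; exact: Hq.
  apply/asboolP => y Hy /=.
  have : `|F (X w) - F y| < F (X w) - a.
    apply: Hr; apply: rV_norm_le; first exact: ltW.
    move=> i; rewrite !mxE; have := Hy i; have := Hq i; rewrite /= => h1 h2.
    have -> : X w ord0 i - y ord0 i = (X w ord0 i - ratr (q ord0 i)) - (y ord0 i - ratr (q ord0 i)).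
      by ring.
    apply: le_trans (ler_normB _ _) _; apply: le_trans nr'.
    by rewrite mulr_natr mulr2n lerD// ltW.
  by move=> /(le_lt_trans (ler_norm _)); rewrite ltrD2l ltrN2.
apply: countable_bigcupT_measurable; first exact: countableP.
move=> p; case: ifP => // _.
apply: fin_bigcap_measurable => // i _.
have mdist : measurable_fun setT (fun w => `|X w ord0 i - ratr (p.1 ord0 i)| < p.2.+1%:R^-1).
  apply: measurable_fun_ltr => //.
  by apply: measurableT_comp => //; exact: measurable_funB.
by rewrite -[X in measurable X]setTI; exact: (mdist measurableT [set true]).
Qed.

(** Normalisation is discontinuous at 0. It is rewritten with the power [- 1 / 2], which is
    measurable on the whole line and agrees with it at 0 too, where both products vanish. *)
Lemma measurable_sphere_proj (disp : measure_display) (Omega : measurableType disp)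
    (R : realType) (d : nat) (Y : Omega -> 'rV[R]_d) :
  (forall i, measurable_fun setT (fun w => Y w ord0 i)) ->
  forall i, measurable_fun setT (fun w => sphere_proj (Y w) ord0 i).
Proof.
move=> mY i.
have -> : (fun w => sphere_proj (Y w) ord0 i) =
    (fun w => inner (Y w) (Y w) `^ (- 2^-1) * Y w ord0 i).
  apply/funext => w; rewrite /sphere_proj !mxE powRN powR12_sqrt ?inner_ge0//.
  by rewrite enormE.
apply: measurable_funM => //.
apply: (measurableT_comp (f := fun z => z `^ (- 2^-1))); first exact: measurable_powR.
by apply: measurable_sum => j; exact: measurable_funM.
Qed.

Definition coord_continuous (R : realType) (d : nat) (F : R -> 'rV[R]_d -> 'rV[R]_d)
    (T : R) : Prop :=
  forall t i x e, 0 <= t <= T -> 0 < e -> exists2 r : R, 0 < r &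
    forall y, `|x - y| <= r -> `|F t x ord0 i - F t y ord0 i| < e.

Lemma measurable_euler (disp : measure_display) (Omega : measurableType disp)
    (R : realType) (d : nat) (b sigma : R -> 'rV[R]_d -> 'rV[R]_d) (T : R)
    (B : R -> Omega -> R) (t D : R) (x : 'rV[R]_d) (n k : nat) :
  coord_continuous b T -> coord_continuous sigma T ->
  (forall s, measurable_fun setT (B s)) ->
  0 <= t -> 0 <= D -> t + n%:R * D <= T -> (k <= n)%N ->
  forall i, measurable_fun setT (fun w => euler b sigma (B^~ w) t D x k ord0 i).
Proof.
move=> cb cs mB t0 D0 tT; elim: k => [|k IH] kn i /=; first exact: measurable_cst.
have mE := IH (ltnW kn).
have tk : 0 <= t + k%:R * D <= T.
  have kD : 0 <= k%:R * D by exact: mulr_ge0.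
  apply/andP; split; first exact: addr_ge0.
  by apply: le_trans tT; rewrite lerD2l ler_wpM2r// ler_nat ltnW.
apply: measurable_sphere_proj => j; rewrite /euler_step.
under eq_fun do rewrite !mxE.
apply: measurable_funD => //; apply: measurable_funD.
  apply: measurable_funM => //.
  by apply: (@measurable_comp_rV _ _ _ _ (fun y => b _ y ord0 j)) => // y e; exact: cb.
apply: measurable_funM; first exact: measurable_funB.
by apply: (@measurable_comp_rV _ _ _ _ (fun y => sigma _ y ord0 j)) => // y e; exact: cs.
Qed.

(** One process is built for all [w], measurable without restriction; the solution property is then
    purely pathwise and holds for each [w] with a Hölder driver. *)
Lemma sphere_process (disp : measure_display) (Omega : measurableType disp)
    (R : realType) (d : nat) (b sigma : R -> 'rV[R]_d -> 'rV[R]_d)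
    (T eta gamma M : R) (B : R -> Omega -> R) (t : R) (x : 'rV[R]_d) :
  0 < eta -> eta <= gamma -> gamma <= 1 -> 1 < eta + gamma -> 0 <= M ->
  sphere_holder b T eta M -> sphere_holder sigma T eta M ->
  coord_continuous b T -> coord_continuous sigma T ->
  (forall (s : R) y, 0 <= s <= T -> unit_sphere y -> inner y (b s y) = 0) ->
  (forall (s : R) y, 0 <= s <= T -> unit_sphere y -> inner y (sigma s y) = 0) ->
  (forall s, measurable_fun setT (B s)) ->
  0 <= t -> t <= T -> unit_sphere x ->
  exists2 X : R -> Omega -> 'rV[R]_d,
    forall s i, measurable_fun setT (fun w => X s w ord0 i) &
    forall w, (exists2 Cg, 0 <= Cg & holder_bound (B^~ w) 0 T gamma Cg) ->
      [/\ forall s, t <= s <= T -> unit_sphere (X s w),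
          holder_on gamma t T (X^~ w) &
          forall s, t <= s <= T -> exists J : 'rV[R]_d,
            (forall i, is_RS_integral (fun r => sigma r (X r w) ord0 i) (B^~ w)
                         t s (J ord0 i)) /\
            X s w = x + \row_i \int[lebesgue_measure]_(r in `[t, s]) b r (X r w) ord0 i + J].
Proof.
move=> eta0 etag gam1 th1 M0 hb hs cb cs tb ts mB t0 tT x1.
pose E n w := euler b sigma (B^~ w) t (dyadic_mesh t T n) x.
pose idx m n k := (k * 2 ^ (n - m))%N.
have DT n : t + (2 ^ n)%:R * dyadic_mesh t T n <= T.
  by rewrite dyadic_mesh_total addrC subrK.
have idx_le m n k : (k <= 2 ^ m)%N -> (m <= n)%N -> (idx m n k <= 2 ^ n)%N.
  by move=> km mn; rewrite -{2}(subnKC mn) expnD leq_pmul2r ?expn_gt0.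
(* Codes of triples (level, index, coordinate) enumerate the grid values. The default 0 respects the
   bound 1 and is never met at codes of true grid points once [n >= m]. *)
pose u (q n : nat) (w : Omega) : R :=
  if @unpickle (nat * nat * 'I_d)%type q is Some (m, k, i) then
    if (k <= 2 ^ m)%N && (m <= n)%N then E n w (idx m n k) ord0 i else 0
  else 0.
have mu_ q n : measurable_fun setT (u q n).
  rewrite /u; case: unpickle => [[[m k] i]|]; last exact: measurable_cst.
  have [/andP[km mn]|_] := boolP ((k <= 2 ^ m)%N && (m <= n)%N); last exact: measurable_cst.
  exact: (measurable_euler x cb cs mB t0 (dyadic_mesh_ge0 tT n) (DT n) (idx_le _ _ _ km mn)).
have u1 q n w : `|u q n w| <= 1.
  rewrite /u; case: unpickle => [[[m k] i]|]; last by rewrite normr0.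
  case: ifP => [/andP[km mn]|_]; last by rewrite normr0.
  apply: (le_trans (rV_norm_coord _ _)); apply: unit_sphere_norm.
  exact: (euler_sphere tb ts (B^~ w) t0 (dyadic_mesh_ge0 tT n) (DT n) x1 (idx_le _ _ _ km mn)).
have [z mz Hz] := measurable_cluster_point mu_ u1.
pose Z (w : Omega) (m k : nat) : 'rV[R]_d := \row_i z (pickle (m, k, i)) w.
pose X (s : R) w : 'rV[R]_d :=
  \row_i limn_sup (fun m => Z w m (dyadic_floor t T m s) ord0 i).
have zB q w : `|z q w| <= 1.
  apply/ler_addgt0Pr => e e0; have [n _ /(_ q (ltnSn q)) Hn] := Hz w q.+1 e 0%N e0.
  rewrite -[z q w](subrK (u q n w)) (le_trans (ler_normD _ _))// addrC lerD//.
exists X.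
  move=> s i; rewrite /X; under eq_fun do rewrite mxE.
  apply: measurable_fun_limn_sup => //.
  - by move=> w _; exists 1 => _ [n _ <-]; rewrite (le_trans (ler_norm _))// mxE.
  - move=> w _; exists (- 1) => _ [n _ <-]; rewrite mxE.
    by have := zB (pickle (n, dyadic_floor t T n s, i)) w; rewrite ler_norml => /andP[].
  - by move=> m; rewrite /Z; under eq_fun do rewrite mxE; exact: mz.
move=> w [Cg Cg0 hg].
have acc m k m' k' : (k <= 2 ^ m)%N -> (k' <= 2 ^ m')%N ->
  forall e N, 0 < e -> exists2 n, (N <= n)%N &
    `|Z w m k - E n w (idx m n k)| <= e /\ `|Z w m' k' - E n w (idx m' n k')| <= e.
  move=> km km' e N e0.
  (* Large enough to include the codes of every coordinate of both grid points. *)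
  pose Q := (\max_(i < d) maxn (pickle (m, k, i)) (pickle (m', k', i))).+1.
  have [n + Hn] := Hz w Q e (maxn N (maxn m m')) e0.
  rewrite !geq_max => /and3P[Nn mn m'n]; exists n => //.
  split; apply: rV_norm_le => [|i]; rewrite ?(ltW e0)// !mxE.
    have := Hn (pickle (m, k, i)); rewrite /u pickleK km mn /=; apply.
    by rewrite ltnS (leq_trans _ (leq_bigmax i))// leq_maxl.
  have := Hn (pickle (m', k', i)); rewrite /u pickleK km' m'n /=; apply.
  by rewrite ltnS (leq_trans _ (leq_bigmax i))// leq_maxr.
have [X1 [Xt [eps [L [eps01 L0 HX]]]]] :=
  limit_path eta0 etag gam1 th1 M0 hb hs tb ts t0 tT x1 Cg0 hg acc.
have [XH Xeq] := path_solution eta0 etag gam1 th1 M0 Cg0 hb hs hg t0 X1 eps01 L0 HX.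
split => //; move=> s sT; have [J [HJ XJ]] := Xeq s sT.
by exists J; split => //; rewrite -Xt.
Qed.

(** * Gaussian estimates *)

Lemma normal_prob_tail (R : realType) (m s c : R) (A : set R) :
  s != 0 -> measurable A -> (forall x, A x -> c <= (x - m) ^+ 2 / (4 * s ^+ 2)) ->
  (normal_prob m s A <= (2 * expR (- c))%:E)%E.
Proof.
move=> s0 mA Ac.
(* The density of deviation [s] is compared with that of deviation [2 s]. *)
have s20 : 2 * s != 0 by rewrite mulf_neq0.
have mpdf (a z : R) : measurable_fun [set: R] (fun x => (normal_pdf a z x)%:E).
  by apply/measurable_EFinP; exact: measurable_normal_pdf.
have K0 : 0 <= 2 * expR (- c) by rewrite mulr_ge0 ?expR_ge0.
have peakE : normal_peak s = 2 * normal_peak (2 * s).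
  rewrite /normal_peak.
  have -> : (2 * s) ^+ 2 * pi *+ 2 = 2 ^+ 2 * (s ^+ 2 * pi *+ 2) by move: (pi : R) => p; rewrite !mulr2n; ring.
  rewrite sqrtrM ?sqr_ge0// sqrtr_sqr ger0_norm//.
  by rewrite invfM mulrA divff ?mul1r// pnatr_eq0.
have pt x : A x -> normal_pdf m s x <= 2 * expR (- c) * normal_pdf m (2 * s) x.
  move=> Ax; rewrite !normal_pdfE// peakE /normal_fun.
  have -> : 2 * expR (- c) * (normal_peak (2 * s) * expR (- (x - m) ^+ 2 / ((2 * s) ^+ 2 *+ 2)))
     = 2 * normal_peak (2 * s) * (expR (- c) * expR (- (x - m) ^+ 2 / ((2 * s) ^+ 2 *+ 2))).
    by ring.
  rewrite ler_wpM2l ?mulr_ge0 ?normal_peak_ge0// -expRD ler_expR.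
  have s2 : 0 < s ^+ 2 by rewrite exprn_even_gt0.
  have := Ac x Ax.
  have -> : - (x - m) ^+ 2 / (s ^+ 2 *+ 2) = - 2 * ((x - m) ^+ 2 / (4 * s ^+ 2)).
    by rewrite -[_ ^+ 2 *+ 2]mulr_natr; field.
  have -> : - (x - m) ^+ 2 / ((2 * s) ^+ 2 *+ 2) = - 2^-1 * ((x - m) ^+ 2 / (4 * s ^+ 2)).
    by rewrite -[_ ^+ 2 *+ 2]mulr_natr; field.
  have : 0 <= (x - m) ^+ 2 / (4 * s ^+ 2) by rewrite divr_ge0 ?sqr_ge0// mulr_ge0// sqr_ge0.
  by clear; lra.
rewrite /normal_prob.
apply: (@le_trans _ _ (\int[lebesgue_measure]_(x in A) ((2 * expR (- c))%:E * (normal_pdf m (2 * s) x)%:E))%E).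
  apply: ge0_le_integral => //.
  - by move=> x _; rewrite lee_fin normal_pdf_ge0.
  - by apply: measurable_funTS; exact: mpdf.
  - apply: emeasurable_funM; first exact: measurable_cst.
    by apply: measurable_funTS; exact: mpdf.
rewrite ge0_integralZl//; last 2 first.
- by apply: measurable_funTS; exact: mpdf.
- by move=> x _; rewrite lee_fin normal_pdf_ge0.
rewrite -[leRHS]mule1 lee_pmul2l// ?lte_fin ?mulr_gt0 ?expR_gt0//.
rewrite -(integral_normal_pdf m (2 * s)).
apply: ge0_subset_integral => //; first exact: mpdf.
by move=> x _; rewrite lee_fin normal_pdf_ge0.
Qed.

Lemma normal_prob_ball (R : realType) (m s c r : R) : s != 0 -> 0 <= r ->
  (normal_prob m s `[(c - r)%R, (c + r)%R] <= (r / `|s|)%:E)%E.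
Proof.
move=> s0 r0; rewrite /normal_prob.
apply: (@le_trans _ _ (\int[lebesgue_measure]_(x in `[(c - r)%R, (c + r)%R]) (normal_peak s)%:E)%E).
  apply: ge0_le_integral => //.
  - by move=> x _; rewrite lee_fin normal_pdf_ge0.
  - by apply: measurable_funTS; apply/measurable_EFinP; exact: measurable_normal_pdf.
  - by move=> x _; rewrite lee_fin normal_pdf_ub.
rewrite integral_cst//= lebesgue_measure_itv/= lte_fin.
have s1 : 0 < `|s| by rewrite normr_gt0.
(* The square root of [2 * pi * s ^ 2] is at least [2 * |s|], since [pi >= 2]. *)
have peak_le : normal_peak s <= (2 * `|s|)^-1.
  rewrite lef_pV2 ?posrE ?mulr_gt0//; last first.
    by rewrite sqrtr_gt0 mulrn_wgt0// mulr_gt0 ?pi_gt0// exprn_even_gt0.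
  rewrite -(ler_pXn2r (_ : (0 < 2)%N)) ?nnegrE ?mulr_ge0//.
  have p0 : 0 <= s ^+ 2 * pi *+ 2.
    by apply: mulrn_wge0; apply: mulr_ge0; [exact: sqr_ge0|exact: pi_ge0].
  rewrite (sqr_sqrtr p0).
  rewrite exprMn real_normK ?num_real// -[_ *+ 2]mulr_natr.
  have := ler_wpM2l (sqr_ge0 s) (pi_ge2 R); clear; lra.
case: ifPn => [_|_]; last by rewrite mule0 lee_fin divr_ge0.
rewrite -EFinB -EFinM lee_fin.
have -> : c + r - (c - r) = 2 * r by ring.
apply: (@le_trans _ _ ((2 * `|s|)^-1 * (2 * r))).
  by rewrite ler_wpM2r// mulr_ge0.
by rewrite invfM mulrACA mulVf// mul1r mulrC.
Qed.

Section CenteredGaussian.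
Context {disp : measure_display} {Omega : measurableType disp} {R : realType}.
Context {P : probability Omega R}.

(** The expectation is the integral of the tail, and the tail at [r] is at most
    [2 * exp (- r / (4 s ^ 2))], which is [8 * s ^ 2] times an exponential density of total mass
    1. *)
Lemma gaussian_second_moment (X : {RV P >-> R}) (m s : R) :
  (forall A : set R, measurable A -> P (X @^-1` A) = gaussian_law m s A) ->
  (expectation P ((X \- cst m) ^+ 2)%R <= (8 * s ^+ 2)%:E)%E.
Proof.
move=> law.
pose Y : {RV P >-> R} := ((X \- cst m) ^+ 2)%R.
have Y0 w : 0 <= Y w by exact: sqr_ge0.
rewrite -[X in expectation P X]/(Y : Omega -> R) (ge0_expectation_ccdf Y0).
pose A (r : R) := [set x : R | r < (x - m) ^+ 2].
have mA r : measurable (A r).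
  have mf : measurable_fun [set: R] (fun x => r < (x - m) ^+ 2).
    by apply: measurable_fun_ltr => //; apply: measurable_funX; exact: measurable_funB.
  by rewrite -[X in measurable X]setTI; exact: (mf measurableT [set true]).
have ccdfE r : ccdf Y r = gaussian_law m s (A r).
  rewrite -law// /ccdf /distribution /pushforward; congr (P _).
  by apply/seteqP; split => w; rewrite /= in_itv/= andbT.
have [s0|s0] := eqVneq s 0.
  rewrite s0 expr0n/= mulr0 integral0_eq// => r /=; rewrite in_itv/= andbT => r0.
  rewrite ccdfE /gaussian_law s0 eqxx diracE memNset// /A/= subrr expr0n/=.
  by apply/negP; rewrite -leNgt.
have s2 : 0 < s ^+ 2 by rewrite exprn_even_gt0.
pose rate := (4 * s ^+ 2)^-1.
have rate0 : 0 < rate by rewrite invr_gt0 mulr_gt0.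
apply: (@le_trans _ _ (\int[lebesgue_measure]_(r in `[0%R, +oo[)
   ((8 * s ^+ 2)%:E * (exponential_pdf rate r)%:E))%E).
  apply: ge0_le_integral => //.
  - by apply: measurable_funTS; exact: ccdf_measurable.
  - apply: measurable_funTS; apply: emeasurable_funM; first exact: measurable_cst.
    by apply/measurable_EFinP; exact: measurable_exponential_pdf.
  - move=> r /=; rewrite in_itv/= andbT => r0.
    rewrite ccdfE /gaussian_law (negbTE s0) exponential_pdfE//.
    have Hc x : A r x -> r * rate <= (x - m) ^+ 2 / (4 * s ^+ 2).
      by move=> /ltW rx; rewrite ler_wpM2r// ltW.
    apply: (le_trans (normal_prob_tail s0 (mA r) Hc)).
    rewrite -EFinM lee_fin.
    have -> : 8 * s ^+ 2 * (rate * expR (- rate * r)) = 2 * expR (- (r * rate)).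
      by rewrite mulNr (mulrC rate r) /rate; field.
    exact: lexx.
rewrite ge0_integralZl//; last 3 first.
- by apply: measurable_funTS; apply/measurable_EFinP; exact: measurable_exponential_pdf.
- by move=> x _; rewrite lee_fin exponential_pdf_ge0// ltW.
- by rewrite lee_fin mulr_ge0// ltW.
have s28 : 0 < 8 * s ^+ 2 by rewrite mulr_gt0.
rewrite -[leRHS]mule1 lee_pmul2l ?lte_fin//.
rewrite -(integral_exponential_pdf rate0).
apply: ge0_subset_integral => //.
  by apply/measurable_EFinP; exact: measurable_exponential_pdf.
by move=> x _; rewrite lee_fin exponential_pdf_ge0// ltW.
Qed.

(* [v = s ^+ 2] is replaced by the cruder [v <= 8 * s ^+ 2] and
   [s ^+ 2 <= 8 * v], which only need tail bounds and Chebyshev's inequality. *)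
Lemma centered_gaussian (X : {RV P >-> R}) (m s v : R) :
  (X : Omega -> R) \in Lfun P 2%:E -> expectation P X = 0%E ->
  variance P X = v%:E -> 0 < v ->
  (forall A : set R, measurable A -> P (X @^-1` A) = gaussian_law m s A) ->
  (forall r, 0 <= r ->
     (P [set w | (`|X w| <= r)%R] <= (3 * r / Num.sqrt v)%:E)%E) /\
  (forall lam, 0 <= lam ->
     (P [set w | (lam <= `|X w|)%R] <= (2 * expR (2 - lam ^+ 2 / (64 * v)))%:E)%E).
Proof.
move=> X2 EX VX v0 law.
have X1 : (X : Omega -> R) \in Lfun P 1 by apply: Lfun_subset12 => //; exact: fin_num_measure.
have EXm : expectation P (X \- cst m) = (- m)%:E.
  rewrite expectationB//; last exact: Lfun_cst.
  by rewrite EX expectation_cst sub0e.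
have Xm2 : (X \- cst m : Omega -> R) \in Lfun P 2%:E.
  by rewrite rpredB ?lee1n//= => _; rewrite Lfun_cst.
(* The left side is the second moment of [X - m], as [X] is centered with variance [v]. It bounds
   [v] and [m ^ 2] at once. *)
have second : v + m ^+ 2 <= 8 * s ^+ 2.
  have : (expectation P ((X \- cst m) ^+ 2)%R - ((- m) ^+ 2)%:E)%E = v%:E.
    by rewrite -VX -(varianceB_cst_r m X2) varianceE// EXm EFin_expe.
  have := gaussian_second_moment law.
  rewrite sqrrN; case: (expectation P _) => [r| |]//=.
  by rewrite lee_fin -EFinB => r8 [<-]; rewrite subrK.
have s0 : s != 0.
  apply/eqP => s0; move: second; rewrite s0 expr0n/= mulr0.
  by have := sqr_ge0 m; move: v0; clear; lra.
have s2 : 0 < s ^+ 2 by rewrite exprn_even_gt0.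
have m2 := sqr_ge0 m.
have lawn A : measurable A -> P (X @^-1` A) = normal_prob m s A.
  by move=> mA; rewrite law// /gaussian_law (negbTE s0).
have sv0 : 0 < Num.sqrt v by rewrite sqrtr_gt0.
split.
  move=> r r0.
  have -> : [set w | (`|X w| <= r)%R] = X @^-1` `[(0 - r)%R, (0 + r)%R].
    by apply/seteqP; split => w /=; rewrite in_itv/= sub0r add0r ler_norml.
  rewrite lawn//; apply: (le_trans (normal_prob_ball _ _ s0 r0)).
  (* [v <= 8 * s ^ 2 <= 9 * s ^ 2], whence the constant 3. *)
  rewrite lee_fin (_ : 3 * r / Num.sqrt v = r * (3 / Num.sqrt v)); last by ring.
  rewrite ler_wpM2l//.
  rewrite ler_pdivlMr// mulrC ler_pdivrMr ?normr_gt0//.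
  rewrite -(ler_pXn2r (_ : (0 < 2)%N)) ?nnegrE ?mulr_ge0 ?sqrtr_ge0//.
  rewrite sqr_sqrtr ?(ltW v0)// exprMn real_normK ?num_real//.
  by move: second m2 s2; clear; lra.
move=> lam lam0.
have mA : measurable [set x : R | lam <= `|x|].
  have mf : measurable_fun [set: R] (fun x : R => lam <= `|x|).
    by apply: measurable_fun_ler => //; exact: measurableT_comp.
  by rewrite -[X in measurable X]setTI; exact: (mf measurableT [set true]).
rewrite -[[set w | _]]/(X @^-1` [set x : R | lam <= `|x|]).
have -> : 2 - lam ^+ 2 / (64 * v) = - (lam ^+ 2 / (64 * v) - 2) by rewrite opprB.
rewrite lawn//; apply: normal_prob_tail => //= x lx.
(* The event that [|X|] is at most [|s| / 2] has probability at most [1 / 2] by the density bound;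
   its complement has at most [4 * v / s ^ 2] by Chebyshev. The sum is at least 1. *)
have s8 : s ^+ 2 <= 8 * v.
  have r0 : 0 < `|s| / 2 by rewrite divr_gt0 ?normr_gt0.
  have small : (P [set w | (`|X w| <= `|s| / 2)%R] <= (2^-1)%:E)%E.
    have -> : [set w | (`|X w| <= `|s| / 2)%R] = X @^-1` `[(0 - `|s| / 2)%R, (0 + `|s| / 2)%R].
      by apply/seteqP; split => w /=; rewrite in_itv/= sub0r add0r ler_norml.
    rewrite lawn//; apply: (le_trans (normal_prob_ball _ _ s0 (ltW r0))).
    by rewrite lee_fin mulrAC divff ?mul1r// normr_eq0.
  have large := chebyshev X r0; rewrite EX VX in large.
  have mX (A : set R) : measurable A -> measurable (X @^-1` A).
    by move=> ?; rewrite -[X in measurable X]setTI; exact: measurable_funP.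
  have mS : measurable [set w | (`|X w| <= `|s| / 2)%R].
    have mf : measurable_fun setT (fun w => (`|X w| <= `|s| / 2)%R).
      by apply: measurable_fun_ler => //; exact: measurableT_comp.
    by rewrite -[X in measurable X]setTI; exact: (mf measurableT [set true]).
  have mL : measurable [set w | (`|s| / 2 <= `|X w - fine 0%E|)%R].
    have mf : measurable_fun setT (fun w => (`|s| / 2 <= `|X w - fine 0%E|)%R).
      apply: measurable_fun_ler => //; apply: measurableT_comp => //.
      exact: measurable_funB.
    by rewrite -[X in measurable X]setTI; exact: (mf measurableT [set true]).
  have : (1 <= (2^-1)%:E + ((`|s| / 2) ^- 2)%:E * v%:E)%E.
    apply: le_trans (leeD small large).
    rewrite -(probability_setT P); apply: le_trans (@measureU2 _ _ _ P _ _ mS mL).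
    apply: le_measure; rewrite ?inE//; first exact: measurableU.
    by move=> w _ /=; rewrite subr0; case: (leP `|X w| (`|s| / 2)) => [|/ltW]; [left|right].
  rewrite -EFinM -EFinD lee_fin exprMn real_normK ?num_real//.
  have -> : (s ^+ 2 * 2^-1 ^+ 2)^-1 * v = 4 * v / s ^+ 2 by field.
  have : 4 * v / s ^+ 2 * s ^+ 2 = 4 * v by rewrite divfK// gt_eqF.
  move: s2; set q := 4 * v / s ^+ 2; clear; nra.
have x2 : lam ^+ 2 <= x ^+ 2.
  by rewrite -(real_normK (num_real x)) lerXn2r ?nnegrE.
(* From [x ^ 2 <= 2 (x - m) ^ 2 + 2 m ^ 2] and [m ^ 2 <= 8 s ^ 2]. Divided by [8 s ^ 2], the last
   term becomes the 2 in the exponent; replacing [s ^ 2] by [8 v] gives the 64. *)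
have x2' : x ^+ 2 <= 2 * (x - m) ^+ 2 + 16 * s ^+ 2.
  by have := sqr_ge0 (x - 2 * m); move: second v0; clear; nra.
rewrite lerBlDr.
apply: (@le_trans _ _ (lam ^+ 2 / (8 * s ^+ 2))).
  have s28 : 0 < 8 * s ^+ 2 by rewrite mulr_gt0.
  have v64 : 0 < 64 * v by rewrite mulr_gt0.
  rewrite ler_wpM2l ?sqr_ge0// lef_pV2 ?posrE//.
  by move: s8; clear; lra.
have -> : (x - m) ^+ 2 / (4 * s ^+ 2) + 2 = (2 * (x - m) ^+ 2 + 16 * s ^+ 2) / (8 * s ^+ 2).
  by field.
have s28 : 0 <= (8 * s ^+ 2)^-1 by rewrite invr_ge0 mulr_ge0// ltW.
exact: (ler_wpM2r s28 (le_trans x2 x2')).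
Qed.

End CenteredGaussian.

(** * Hölder continuity of fractional Brownian motion *)

Lemma leq_double_cases (p q : nat) :
  (2 * p < q.+1)%N -> (q < 2 * p.+1)%N -> q = (2 * p)%N \/ q = (2 * p).+1.
Proof. by lia. Qed.

Lemma leq_succ_cases (p q : nat) : (p <= q)%N -> (q < p.+2)%N -> q = p \/ q = p.+1.
Proof. by lia. Qed.

Section Chaining.
Context {R : realType}.
Variables (f : R -> R) (T gamma : R) (N : nat).
Hypotheses (T0 : 0 < T) (gam0 : 0 < gamma) (gam1 : gamma <= 1).
Hypothesis cf : {within `[0, T], continuous f}.
Local Notation D := (dyadic_mesh 0 T).
Hypothesis increments : forall n k, (N <= n)%N -> (k < 2 ^ n)%N ->
  `|f (k.+1%:R * D n) - f (k%:R * D n)| <= D n `^ gamma.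

Let fl m s := dyadic_floor 0 T m s.
Let T0' : 0 <= T := ltW T0.

Let D_gt0 n : 0 < D n.
Proof. by rewrite divr_gt0 ?subr0 ?exprn_gt0. Qed.

Let D_half n : D n = 2 * D n.+1.
Proof. by rewrite /dyadic_mesh exprS invfM mulrCA [2 * _]mulrA divff// mul1r. Qed.

Let flP m s : 0 <= s <= T -> [/\ (fl m s <= 2 ^ m)%N, (fl m s)%:R * D m <= s &
  s < (fl m s).+1%:R * D m].
Proof.
move=> sT; have [k2 k1 _] := dyadic_floorP T0' m sT.
rewrite add0r in k1; split => //.
have /andP[s0 _] := sT; have s0' : 0 <= (s - 0) / D m by rewrite subr0 divr_ge0// ltW.
have /andP[_] := truncn_itv s0'; rewrite ltr_pdivrMr ?D_gt0// -/(dyadic_floor 0 T m s) -/(fl m s).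
by rewrite subr0.
Qed.

Let kappa : R := 2^-1 `^ gamma.

Let kappa01 : 0 < kappa < 1.
Proof.
rewrite powR_gt0 ?invr_gt0//=.
apply: (@lt_le_trans _ _ (1 `^ gamma)); last by rewrite powR1.
by apply: gt0_ltr_powR; rewrite ?nnegrE//; lra.
Qed.

Let Dg n : D n.+1 `^ gamma = kappa * D n `^ gamma.
Proof.
have D2 : 0 <= 2 * D n.+1 by apply: mulr_ge0 => //; exact: ltW.
by rewrite (D_half n) /kappa -powRM// mulKf.
Qed.

(** Sum of the geometric series [kappa + kappa ^ 2 + ...], where [kappa] is the ratio of the bounds
    on two consecutive levels. *)
Let K : R := kappa / (1 - kappa).

Let K0 : 0 <= K.
Proof. by have /andP[k0 k1] := kappa01; rewrite divr_ge0 ?subr_ge0 ?ltW. Qed.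

Let floor_step m s : 0 <= s <= T -> (N <= m)%N ->
  `|f ((fl m.+1 s)%:R * D m.+1) - f ((fl m s)%:R * D m)| <= D m.+1 `^ gamma.
Proof.
move=> sT Nm; have [a1 a2 a3] := flP m sT; have [b1 b2 b3] := flP m.+1 sT.
have kE : (fl m s)%:R * D m = (2 * fl m s)%:R * D m.+1.
  by rewrite D_half mulrA natrM [_ * 2]mulrC.
have h1 : (2 * fl m s < (fl m.+1 s).+1)%N.
  rewrite -(ltr_nat R) -(ltr_pM2r (D_gt0 m.+1)) -kE.
  exact: le_lt_trans b3.
have h2 : (fl m.+1 s < 2 * (fl m s).+1)%N.
  rewrite -(ltr_nat R) -(ltr_pM2r (D_gt0 m.+1)) (le_lt_trans b2)//.
  by rewrite natrM -mulrA [_ * D m.+1]mulrC mulrA -D_half mulrC.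
rewrite kE.
have [e|e] := leq_double_cases h1 h2.
  by rewrite e subrr normr0 powR_ge0.
rewrite e; apply: increments; first exact: leq_trans Nm (leqnSn m).
by rewrite -e.
Qed.

Let floor_chain m n s : 0 <= s <= T -> (N <= m)%N ->
  `|f ((fl (m + n) s)%:R * D (m + n)) - f ((fl m s)%:R * D m)|
    <= K * (D m `^ gamma - D (m + n) `^ gamma).
Proof.
move=> sT Nm; elim: n => [|n IH].
  by rewrite addn0 !subrr normr0 mulr0.
have := floor_step sT (leq_trans Nm (leq_addr n m)); rewrite addnS Dg.
set x := D (m + n) `^ gamma in IH *.
set F1 := f (_ * D (m + n).+1); set F2 := f (_ * D (m + n)) in IH *; set F3 := f _ in IH *.
move=> IH1; have -> : F1 - F3 = (F1 - F2) + (F2 - F3) by rewrite addrA subrK.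
apply: le_trans (ler_normD _ _) _.
have /andP[k0 k1] := kappa01.
have Kk : K * (1 - kappa) = kappa by rewrite divfK// gt_eqF// subr_gt0.
apply: (le_trans (lerD IH1 IH)); set y := D m `^ gamma.
have -> : K * (y - kappa * x) = (K * (1 - kappa)) * x + K * (y - x) by ring.
by rewrite Kk.
Qed.

(** The chain of floors gives the bound up to any finer level; continuity of [f] at [s] lets that
    level tend to infinity. *)
Let f_floor m s : 0 <= s <= T -> (N <= m)%N ->
  `|f s - f ((fl m s)%:R * D m)| <= K * D m `^ gamma.
Proof.
move=> sT Nm; apply/ler_addgt0Pr => e e0.
have := (@subspace_continuousP _ _ _ _).1 cf s; rewrite /= in_itv/= => /(_ sT).
move/cvgrPdist_le => /(_ _ e0); rewrite near_withinE => /nbhs_ballP[r /= r0 Hr].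
have [n Nn Dn] := dyadic_mesh_small T0' m (divr_gt0 r0 (ltr0Sn R 1)).
have [c1 c2 c3] := flP n sT.
have p0 : 0 <= (fl n s)%:R * D n by rewrite mulr_ge0// ltW.
have pT : (fl n s)%:R * D n <= T.
  by have /andP[_ ] := sT; exact: le_trans.
have close : `|f s - f ((fl n s)%:R * D n)| <= e.
  apply: Hr; last by rewrite /= in_itv/= p0 pT.
  rewrite -ball_normE /= ger0_norm ?subr_ge0//.
  move: c3; rewrite -natr1 mulrDl mul1r => c3.
  by move: Dn c3 r0; lra.
have := floor_chain (n - m) sT Nm; rewrite subnKC// => ch.
have -> : f s - f ((fl m s)%:R * D m) = (f ((fl n s)%:R * D n) - f ((fl m s)%:R * D m))
   + (f s - f ((fl n s)%:R * D n)) by ring.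
apply: le_trans (ler_normD _ _) _; apply: lerD => //; apply: (le_trans ch).
by rewrite ler_wpM2l// gerBl powR_ge0.
Qed.

Let grid_bound j k : (j <= k)%N -> (k <= 2 ^ N)%N ->
  `|f (k%:R * D N) - f (j%:R * D N)| <= (k - j)%:R * D N `^ gamma.
Proof.
move=> jk; rewrite -(subnKC jk); move: (k - j)%N => n {k jk}.
elim: n => [|n IH] nN; first by rewrite addn0 !subrr normr0 subnn mul0r.
rewrite addKn in IH; rewrite addKn; rewrite addnS in nN *.
have -> : f ((j + n).+1%:R * D N) - f (j%:R * D N) =
    (f ((j + n)%:R * D N) - f (j%:R * D N)) + (f ((j + n).+1%:R * D N) - f ((j + n)%:R * D N)).
  by ring.
apply: le_trans (ler_normD _ _) _; rewrite -[n.+1%:R]natr1 mulrDl mul1r.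
by apply: lerD; [exact: IH (ltnW nN)|exact: increments].
Qed.

Lemma dyadic_chaining : exists2 C : R, 0 <= C & holder_bound f 0 T gamma C.
Proof.
pose C := (2 * K + (2 ^ N)%:R) + (2 * K + 1) * 2.
have K2 : 0 <= 2 * K by rewrite mulr_ge0.
have C0 : 0 <= C by rewrite !addr_ge0// mulr_ge0// addr_ge0.
exists C => //.
suff H u v : 0 <= u <= T -> 0 <= v <= T -> u < v -> `|f v - f u| <= C * (v - u) `^ gamma.
  move=> u v uT vT; case: (ltgtP u v) => [uv|vu|->].
  - by rewrite distrC (distrC u) (gtr0_norm (_ : 0 < v - u)) ?subr_gt0//; exact: H.
  - by rewrite (gtr0_norm (_ : 0 < u - v)) ?subr_gt0//; exact: H.
  - by rewrite !subrr normr0 mulr_ge0 ?powR_ge0.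
move=> uT vT uv; have vu0 : 0 < v - u by rewrite subr_gt0.
have floors m : (N <= m)%N -> `|f v - f u| <=
    2 * K * D m `^ gamma + `|f ((fl m v)%:R * D m) - f ((fl m u)%:R * D m)|.
  move=> Nm; have e1 := f_floor uT Nm; have e2 := f_floor vT Nm.
  set fu := f (_ * _) in e1 *; set fv := f (_ * _) in e2 *.
  have -> : f v - f u = ((f v - fv) - (f u - fu)) + (fv - fu) by ring.
  apply: le_trans (ler_normD _ _) _; rewrite lerD2r.
  by apply: le_trans (ler_normB _ _) _; move: e1 e2; lra.
have vg0 : 0 <= (v - u) `^ gamma by exact: powR_ge0.
have [big|small] := leP (D N) (v - u).
  have Dv : D N `^ gamma <= (v - u) `^ gamma by rewrite powR_le_base ?(ltW gam0) ?(ltW (D_gt0 _)).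
  apply: (le_trans (floors N (leqnn N))).
  have lefl : (fl N u <= fl N v)%N by apply: (dyadic_floor_le T0'); exact: ltW.
  have [flv _ _] := flP N vT.
  have g1 := grid_bound lefl flv.
  have g2 : (fl N v - fl N u)%:R * D N `^ gamma <= (2 ^ N)%:R * D N `^ gamma.
    by rewrite ler_wpM2r ?powR_ge0// ler_nat (leq_trans (leq_subr _ _)).
  apply: (@le_trans _ _ ((2 * K + (2 ^ N)%:R) * D N `^ gamma)).
    by rewrite [leRHS]mulrDl lerD2l (le_trans g1).
  apply: (@le_trans _ _ ((2 * K + (2 ^ N)%:R) * (v - u) `^ gamma)).
    by rewrite ler_wpM2l// addr_ge0.
  by rewrite ler_wpM2r// /C lerDl mulr_ge0// addr_ge0.
have exm : exists m, D m <= v - u.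
  by have [m _ Dm] := dyadic_mesh_small T0' 0 vu0; exists m.
(* At the level just before this minimal one the mesh exceeds [v - u], so the floors of [u] and [v]
   are equal or adjacent, and the mesh is still at most [2 * (v - u)]. *)
have [m Dm mmin] := ex_minnP exm.
have mN : (N < m)%N.
  by rewrite ltnNge; apply/negP => mN; move: small; rewrite ltNge (le_trans (dyadic_mesh_le T0' mN)).
case: m Dm mmin mN => // m Dm mmin Nm; rewrite ltnS in Nm.
have Dm' : v - u < D m by rewrite ltNge; apply/negP => /mmin; rewrite ltnn.
have [p1 p2 p3] := flP m uT; have [q1 q2 q3] := flP m vT.
have lefl : (fl m u <= fl m v)%N by apply: (dyadic_floor_le T0'); exact: ltW.
have lefl2 : (fl m v < (fl m u).+2)%N.
  rewrite -(ltr_nat R) -(ltr_pM2r (D_gt0 m)) (le_lt_trans q2)//.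
  rewrite -[(fl m u).+2%:R]natr1 mulrDl mul1r.
  by move: p3 Dm'; set w := _ * D m; lra.
have step : `|f ((fl m v)%:R * D m) - f ((fl m u)%:R * D m)| <= D m `^ gamma.
  have [->|e] := leq_succ_cases lefl lefl2.
    by rewrite subrr normr0 powR_ge0.
  by rewrite e; apply: increments => //; rewrite -e.
apply: (le_trans (floors m Nm)).
have DD : D m `^ gamma <= 2 * (v - u) `^ gamma.
  rewrite D_half powRM ?(ltW (D_gt0 _))//; apply: ler_pM; rewrite ?powR_ge0//.
    by apply: ler1_powR => //; rewrite ler1n.
  by rewrite powR_le_base ?(ltW gam0) ?(ltW (D_gt0 _)).
have : (2 * K + 1) * D m `^ gamma <= (2 * K + 1) * (2 * (v - u) `^ gamma).
  by rewrite ler_wpM2l// addr_ge0.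
have : 0 <= (2 * K + (2 ^ N)%:R) * (v - u) `^ gamma by rewrite mulr_ge0// addr_ge0.
by rewrite /C; move: step; lra.
Qed.

End Chaining.

(** * Moments and laws of the increments of fractional Brownian motion *)

Lemma Lfun2_of_second_moment (disp : measure_display) (Omega : measurableType disp)
    (R : realType) (P : probability Omega R) (X : {RV P >-> R}) :
  (expectation P ((X : Omega -> R) ^+ 2)%R < +oo)%E -> (X : Omega -> R) \in Lfun P 2%:E.
Proof.
move=> X2; rewrite inE/=; apply/andP; split; rewrite inE//=.
rewrite /finite_norm unlock poweR_lty//.
move: X2; rewrite unlock; apply: le_lt_trans.
rewrite le_eqVlt; apply/orP; left; apply/eqP; apply: eq_integral => w _.
by rewrite poweR_EFin powR_mulrn ?normr_ge0// real_normK// num_real.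
Qed.

Section FractionalBrownianMotion.
Context {disp : measure_display} {Omega : measurableType disp} {R : realType}.
Context {P : probability Omega R}.
Variables (H : R) (B : R -> {RV P >-> R}).
Hypotheses (H0 : 0 < H) (fbm : fractional_brownian_motion H B).

Let covE : forall s t, 0 <= s -> 0 <= t ->
  covariance P (B s) (B t) = (fbm_covariance H s t)%:E.
Proof. by have [] := fbm. Qed.

Let meanE : forall t, 0 <= t -> expectation P (B t) = 0%E.
Proof. by have [] := fbm. Qed.

Let varE t : 0 <= t -> variance P (B t) = (t `^ (2 * H))%:E.
Proof.
move=> t0; rewrite /variance covE// /fbm_covariance subrr normr0 powR0.
  by congr EFin; field.
by rewrite gt_eqF// mulr_gt0.
Qed.

(** Square integrability is read off the covariance: at [(t, t)] it unfolds to the second moment,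
    the mean being 0, and its prescribed value is finite. *)
Lemma fbm_Lfun2 t : 0 <= t -> (B t : Omega -> R) \in Lfun P 2%:E.
Proof.
move=> t0; apply: Lfun2_of_second_moment.
have := varE t0; rewrite /variance unlock meanE//= => EB.
rewrite (_ : (B t : Omega -> R) ^+ 2 = ((B t \- cst 0) * (B t \- cst 0))%R :> (Omega -> R)); last first.
  by apply/funext => w /=; rewrite !fctE/= subr0.
by rewrite EB ltry.
Qed.

Lemma fbm_increment_var s t : 0 <= s -> 0 <= t ->
  variance P (B t \- B s) = (`|t - s| `^ (2 * H))%:E.
Proof.
move=> s0 t0; rewrite varianceB ?fbm_Lfun2// !varE// covE//.
rewrite -EFinM -?EFinD -?EFinB; congr EFin; rewrite /fbm_covariance distrC.
by field.
Qed.

Lemma fbm_increment_mean s t : 0 <= s -> 0 <= t ->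
  expectation P (B t \- B s) = 0%E.
Proof.
move=> s0 t0; have L1 r : 0 <= r -> (B r : Omega -> R) \in Lfun P 1.
  by move=> r0; apply: Lfun_subset12; [exact: fin_num_measure|exact: fbm_Lfun2].
by rewrite expectationB ?L1// !meanE// sube0.
Qed.

Lemma fbm_increment_law s t : 0 <= s -> 0 <= t -> exists m v : R,
  forall A : set R, measurable A ->
    P ((B t \- B s : {RV P >-> R}) @^-1` A) = gaussian_law m v A.
Proof.
move=> s0 t0; have [gp _ _ _] := fbm.
pose a (k : 'I_2) : R := if k == ord0 then 1 else - 1.
pose u (k : 'I_2) : R := if k == ord0 then t else s.
have [k|m [v law]] := gp 2%N a u; first by rewrite /u; case: ifP.
exists m, v => A mA; rewrite -law//.
have E w : (B t \- B s)%R w = (\sum_(k < 2) a k * B (u k) w)%R.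
  by rewrite !big_ord_recl big_ord0 /a /u /= mul1r mulN1r addr0.
by congr (P _); apply/seteqP; split => w; rewrite /preimage /= -E.
Qed.

Lemma fbm_increment_bounds s t : 0 <= s -> s < t ->
  (forall r, 0 <= r ->
     (P [set w | (`|B t w - B s w| <= r)%R] <= (3 * r / (t - s) `^ H)%:E)%E) /\
  (forall lam, 0 <= lam ->
     (P [set w | (lam <= `|B t w - B s w|)%R]
        <= (2 * expR (2 - lam ^+ 2 / (64 * (t - s) `^ (2 * H))))%:E)%E).
Proof.
move=> s0 st; have t0 : 0 <= t by exact: le_trans (ltW st).
have ts0 : 0 < t - s by rewrite subr_gt0.
have [m [v law]] := fbm_increment_law s0 t0.
have X2 : (B t \- B s : Omega -> R) \in Lfun P 2%:E.
  by rewrite rpredB ?lee1n//= => *; exact: fbm_Lfun2.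
have VX := fbm_increment_var s0 t0; rewrite gtr0_norm// in VX.
have v0 : 0 < (t - s) `^ (2 * H) by exact: powR_gt0.
have := centered_gaussian X2 (fbm_increment_mean s0 t0) VX v0 law.
by rewrite -powR12_sqrt ?(ltW v0)// -powRrM (_ : 2 * H * 2^-1 = H)//; field.
Qed.

End FractionalBrownianMotion.

(* Sub-Gaussian tails beat the [2 ^ n] increments at level [n]. *)
Lemma dyadic_tail_bound (R : realType) (T H gamma : R) :
  0 < T -> gamma < H -> exists C : R, 0 <= C /\ exists N : nat, forall n, (N <= n)%N ->
  (2 ^ n)%:R * (2 * expR (2 - (dyadic_mesh 0 T n `^ gamma) ^+ 2
                             / (64 * dyadic_mesh 0 T n `^ (2 * H)))) <= C / 2 ^+ n.
Proof.
move=> T0 gH; pose ep := H - gamma.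
have ep0 : 0 < ep by rewrite subr_gt0.
(* Makes [2 * ep * (j + 1) >= 2], so that the term of order [j + 1] of the exponential series yields
   a factor [D ^ 2], of order [4 ^ (- n)], against the [2 ^ n] increments. *)
pose j := Num.truncn ep^-1.
have jep : 2 <= 2 * ep * j.+1%:R.
  have : ep^-1 <= j.+1%:R by apply: ltW; exact: truncnS_gt.
  by rewrite -[in X in X -> _]div1r ler_pdivrMr// => h; move: h; rewrite mulrC; lra.
pose q : R := (j.+1)`!%:R.
have q0 : 0 < q by rewrite ltr0n fact_gt0.
exists (2 * expR 2 * (q * 64 ^+ j.+1) * T ^+ 2).
split; first by rewrite !mulr_ge0 ?expR_ge0 ?exprn_ge0 ?(ltW q0)// ltW.
have [N _ DN] := dyadic_mesh_small (ltW T0) 0 ltr01.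
exists N => n Nn; set D := dyadic_mesh 0 T n.
have D0 : 0 < D by rewrite divr_gt0 ?subr0 ?exprn_gt0.
have D1 : D <= 1 by rewrite (le_trans _ DN)// dyadic_mesh_le// ltW.
pose z := D `^ (2 * ep).
have z0 : 0 < z by exact: powR_gt0.
have yE : (D `^ gamma) ^+ 2 / (64 * D `^ (2 * H)) = (64 * z)^-1.
  have -> : D `^ (2 * H) = (D `^ gamma) ^+ 2 * z.
    have -> : (D `^ gamma) ^+ 2 = D `^ (gamma * 2) by rewrite powRrM powR_mulrn ?powR_ge0.
    rewrite /z -powRD; last by rewrite (gt_eqF D0) implybT.
    by congr (_ `^ _); rewrite /ep; ring.
  by field; rewrite !gt_eqF ?powR_gt0.
rewrite yE.
have y0 : 0 < (64 * z)^-1 by rewrite invr_gt0 mulr_gt0.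
have ebound : expR (2 - (64 * z)^-1) <= expR 2 * (q * 64 ^+ j.+1 * D ^+ 2).
  rewrite expRD ler_wpM2l ?expR_ge0// expRN.
  have e1 := expR_ge1Dxn j (ltW y0).
  have e2 : (64 * z)^-1 ^+ j.+1 / q <= expR (64 * z)^-1.
    by apply: le_trans e1; rewrite lerDr.
  have e3 : 0 < (64 * z)^-1 ^+ j.+1 / q by rewrite divr_gt0 ?exprn_gt0.
  apply: (@le_trans _ _ ((64 * z)^-1 ^+ j.+1 / q)^-1).
    by rewrite lef_pV2 ?posrE ?expR_gt0.
  rewrite invfM invrK -exprVn invrK mulrC exprMn -mulrA ler_wpM2l ?(ltW q0)//.
  rewrite ler_wpM2l ?exprn_ge0//.
  have -> : z ^+ j.+1 = D `^ (2 * ep * j.+1%:R) by rewrite -(powR_mulrn j.+1 (ltW z0)) /z -powRrM.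
  rewrite -(powR_mulrn 2 (ltW D0)); apply: powR_le_exp; first by rewrite (ltW D0).
  by rewrite ltr0n.
apply: (@le_trans _ _ ((2 ^ n)%:R * (2 * (expR 2 * (q * 64 ^+ j.+1 * D ^+ 2))))).
  by rewrite ler_wpM2l// ler_wpM2l.
rewrite natrX /D /dyadic_mesh subr0 le_eqVlt; apply/orP; left; apply/eqP.
by field; rewrite expf_neq0.
Qed.

Section FbmHolder.
Context {disp : measure_display} {Omega : measurableType disp} {R : realType}.
Context {P : probability Omega R}.
Variables (H : R) (B : R -> {RV P >-> R}).
Hypotheses (H0 : 0 < H) (fbm : fractional_brownian_motion H B).

(** The probability that some increment of level [N + n] exceeds its mesh to the power [gamma] is at
    most [C / 2 ^ n]. By Borel-Cantelli, chaining applies from a level depending on [w]. *)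
Lemma fbm_holder (T gamma : R) : 0 < T -> 0 < gamma -> gamma <= 1 -> gamma < H ->
  \forall w \ae P, exists2 C : R, 0 <= C & holder_bound (fun t => B t w) 0 T gamma C.
Proof.
move=> T0 gam0 gam1 gH.
have [C [C0 [N HN]]] := dyadic_tail_bound T0 gH.
pose D n := dyadic_mesh 0 T n.
have D0 n : 0 < D n by rewrite divr_gt0 ?subr0 ?exprn_gt0.
pose A n k := [set w | D n `^ gamma <= `|B (k.+1%:R * D n) w - B (k%:R * D n) w|].
have mA n k : measurable (A n k).
  have mf : measurable_fun setT
      (fun w => D n `^ gamma <= `|B (k.+1%:R * D n) w - B (k%:R * D n) w|).
    apply: measurable_fun_ler => //; apply: measurableT_comp => //.
    exact: measurable_funB.
  by rewrite -[X in measurable X]setTI; exact: (mf measurableT [set true]).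
pose G n := \big[setU/set0]_(k < 2 ^ (N + n)) A (N + n)%N k.
have mG n : measurable (G n) by apply: bigsetU_measurable.
have PA n k : (P (A n k) <= (2 * expR (2 - (D n `^ gamma) ^+ 2 / (64 * D n `^ (2 * H))))%:E)%E.
  have k0 : 0 <= k%:R * D n by rewrite mulr_ge0// ltW.
  have kk : k%:R * D n < k.+1%:R * D n by rewrite ltr_pM2r// ltr_nat.
  have DE : k.+1%:R * D n - k%:R * D n = D n by rewrite -mulrBl -natr1 addrAC subrr add0r mul1r.
  have [_] := fbm_increment_bounds H0 fbm k0 kk; rewrite DE; apply.
  exact: powR_ge0.
have PG n : (P (G n) <= (C / (2 ^ n)%:R)%:E)%E.
  apply: (le_trans (@Boole_inequality _ _ _ P (A (N + n)%N) _ _)) => //.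
  apply: (le_trans (lee_sum _ (fun (k : 'I_(2 ^ (N + n))) _ => PA (N + n)%N k))).
  rewrite sumEFin sumr_const card_ord lee_fin -[_ *+ (2 ^ (N + n))]mulr_natl.
  apply: (le_trans (HN _ (leq_addr _ _))).
  rewrite ler_wpM2l// natrX lef_pV2 ?posrE ?exprn_gt0//.
  by rewrite ler_weXn2l ?ler1n// leq_addl.
have sumG : (\sum_(n <oo) P (G n) < +oo)%E.
  have geo := @cvg_geometric_eseries_half R (2 * C) 0.
  apply: (@le_lt_trans _ _ (2 * C / 2 ^+ 0)%:E); last exact: ltry.
  rewrite -(cvg_lim _ geo)//; apply: lee_nneseries => // n _.
  apply: (le_trans (PG n)); rewrite lee_fin addn1 !natrX exprS.
  by rewrite invfM mulrACA divff// mul1r.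
have null := lim_sup_set_cvg0 mG sumG.
have ae1 : \forall w \ae P, ~ lim_sup_set G w.
  exists (lim_sup_set G); split => //.
    apply: bigcapT_measurable => n; exact: bigcup_measurable.
  by move=> w /= /contrapT.
have [_ _ _ cont] := fbm.
apply: filterS2 ae1 cont => w nG cw.
have [M HM] : exists M, forall n, (M <= n)%N -> ~ G n w.
  apply: contrapT => /forallNP h; apply: nG => M _.
  have /existsNP[n /not_implyP[Mn /contrapT Gn]] := h M.
  by exists n.
apply: (@dyadic_chaining _ (fun t => B t w) T gamma (N + M)%N T0 gam0 gam1).
  apply: continuous_subspaceW cw.
  by move=> s /=; rewrite !in_itv/= andbT => /andP[].
move=> n k NMn kn; rewrite leNgt; apply/negP => /ltW lt.
have Nn : (N <= n)%N by rewrite (leq_trans (leq_addr _ _) NMn).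
apply: (HM (n - N)%N); first by rewrite leq_subRL// .
rewrite /G subnKC// -bigcup_mkord; exists k => //=.
Qed.

End FbmHolder.

(** * Tangency of viable paths *)

Lemma sphere_holder_intro (R : realType) (d : nat) (F : R -> 'rV[R]_d -> 'rV[R]_d)
    (T eta nu L M0 M : R) :
  0 < eta -> eta <= nu -> 0 <= L -> L * (1 + d%:R) <= M -> M0 <= M ->
  (forall s t x y, 0 <= s <= T -> 0 <= t <= T -> unit_sphere x -> unit_sphere y ->
     enorm (F t x - F s y) <= L * (`|t - s| `^ nu + enorm (x - y))) ->
  (forall t x, 0 <= t <= T -> unit_sphere x -> `|F t x| <= M0) ->
  sphere_holder F T eta M.
Proof.
move=> eta0 etan L0 LM M0M hF bF; split; last first.
  by move=> t x tT x1; exact: le_trans (bF _ _ tT x1) M0M.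
move=> s t x y sT tT ts1 x1 y1; apply: (le_trans (norm_le_enorm _)).
apply: (le_trans (hF _ _ _ _ sT tT x1 y1)).
have e1 : `|t - s| `^ nu <= `|t - s| `^ eta by rewrite powR_le_exp ?normr_ge0 ?eta0.
have e2 := enorm_le_norm (x - y).
have e0 : 0 <= `|t - s| `^ eta by exact: powR_ge0.
apply: (@le_trans _ _ (L * (1 + d%:R) * (`|t - s| `^ eta + `|x - y|))); last first.
  by rewrite ler_wpM2r// addr_ge0.
rewrite -mulrA ler_wpM2l//.
have d0 : 0 <= d%:R * `|t - s| `^ eta by rewrite mulr_ge0.
have := normr_ge0 (x - y).
by move: e1 e2 e0 d0; clear; rewrite mulrDl mul1r mulrDr; lra.
Qed.

Lemma coord_continuous_lipschitz (R : realType) (d : nat)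
    (F : R -> 'rV[R]_d -> 'rV[R]_d) (T nu : R) : 0 < nu ->
  (forall rho : R, 0 <= rho -> exists2 L : R, 0 < L &
     forall s t x y, s \in `[0, T] -> t \in `[0, T] ->
       enorm x <= rho -> enorm y <= rho ->
       enorm (F t x - F s y) <= L * (`|t - s| `^ nu + enorm (x - y))) ->
  coord_continuous F T.
Proof.
move=> nu0 hF t i x e tT e0.
pose rho := d%:R * (`|x| + 1).
have rho0 : 0 <= rho by rewrite mulr_ge0// addr_ge0.
have [L L0 HL] := hF rho rho0.
have Ld : 0 < L * d%:R + 1 by rewrite ltr_wpDl// mulr_ge0// ltW.
exists (Num.min 1 (e / (L * d%:R + 1))); first by rewrite lt_min ltr01 divr_gt0.
move=> y; rewrite le_min => /andP[xy1 xye].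
have xr : enorm x <= rho.
  by rewrite (le_trans (enorm_le_norm _))// ler_wpM2l// lerDl.
have yr : enorm y <= rho.
  rewrite (le_trans (enorm_le_norm _))// ler_wpM2l//.
  by rewrite -[y](subKr x) (le_trans (ler_normB _ _))// lerD2l.
have tin : t \in `[0, T] by rewrite in_itv.
have := HL t t x y tin tin xr yr; rewrite subrr normr0 powR0 ?gt_eqF// add0r => H.
apply: (@le_lt_trans _ _ `|F t x - F t y|).
  by have := rV_norm_coord (F t x - F t y) i; rewrite !mxE.
apply: (le_lt_trans (norm_le_enorm _)); apply: (le_lt_trans H).
apply: (@le_lt_trans _ _ (L * (d%:R * (e / (L * d%:R + 1))))).
  by rewrite ler_wpM2l ?(ltW L0)// (le_trans (enorm_le_norm _))// ler_wpM2l.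
by rewrite !mulrA ltr_pdivrMr// [ltLHS]mulrC ltr_pM2l// ltrDl.
Qed.

Section Fields.
Context {R : realType} {d : nat}.
Variables (b sigma : R -> 'rV[R]_d -> 'rV[R]_d) (T beta delta mu : R).

Lemma assumptions_sphere_holder (eta : R) :
  0 < eta -> eta <= beta -> eta <= mu ->
  assumption_H1 T beta delta sigma -> assumption_H2 T mu b -> 0 < T ->
  exists2 M : R, 0 <= M & sphere_holder b T eta M /\ sphere_holder sigma T eta M.
Proof.
move=> eta0 eb em [_ [Ms Ms0 hs] _] [hb [L0 L00 lb]] T0.
have [Lb Lb0 {}hb] := hb 1 ler01.
have T0in : 0 \in `[0, T] by rewrite in_itv/= lexx ltW.
have unitE (x : 'rV[R]_d) : unit_sphere x -> enorm x = 1 by [].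
pose Kb := L0 * (1 + 1).
(* The bound for [sigma] comes from its Lipschitz estimate, by comparison with its value at time 0
   and the origin. *)
pose Ks := `|sigma 0 0| + Ms * (T `^ beta + 1).
have d1 : 0 <= 1 + d%:R :> R by rewrite addr_ge0.
have Lbd : 0 <= Lb * (1 + d%:R) by rewrite mulr_ge0// ltW.
have Msd : 0 <= Ms * (1 + d%:R) by rewrite mulr_ge0// ltW.
have Kb0 : 0 <= Kb by rewrite mulr_ge0 ?addr_ge0// ltW.
have Ks0 : 0 <= Ks.
  by apply: addr_ge0 => //; apply: mulr_ge0; [exact: ltW|rewrite addr_ge0// powR_ge0].
pose M := Lb * (1 + d%:R) + Ms * (1 + d%:R) + Kb + Ks.
exists M; first by rewrite /M; apply: addr_ge0 => //; apply: addr_ge0 => //; apply: addr_ge0.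
split.
  apply: (@sphere_holder_intro _ _ _ _ _ mu Lb Kb) => //.
  - exact: ltW.
  - by move: Msd Kb0 Ks0; rewrite /M; lra.
  - by move: Msd Lbd Ks0; rewrite /M; lra.
  - by move=> s t x y sT tT x1 y1; apply: hb; rewrite ?in_itv// ?unitE.
  - move=> t x tT x1; apply: (le_trans (norm_le_enorm _)).
    by apply: (le_trans (lb _ _ _)); rewrite ?in_itv// unitE.
apply: (@sphere_holder_intro _ _ _ _ _ beta Ms Ks) => //.
- exact: ltW.
- by move: Lbd Kb0 Ks0; rewrite /M; lra.
- by move: Msd Lbd Kb0; rewrite /M; lra.
- by move=> s t x y sT tT x1 y1; apply: hs; rewrite ?in_itv.
move=> t x tT x1.
have -> : sigma t x = sigma 0 0 + (sigma t x - sigma 0 0) by rewrite addrC subrK.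
apply: le_trans (ler_normD _ _) _; rewrite lerD2l.
apply: (le_trans (norm_le_enorm _)); apply: (le_trans (hs 0 t x 0 T0in _)).
  by rewrite in_itv.
rewrite !subr0 ler_wpM2l ?(ltW Ms0)// unitE// lerD2r.
have /andP[t0 tT'] := tT; rewrite ger0_norm// powR_le_base//.
by rewrite ltW// (lt_le_trans eta0).
Qed.

Lemma assumptions_coord_continuous :
  0 < beta -> 0 < mu ->
  assumption_H1 T beta delta sigma -> assumption_H2 T mu b ->
  coord_continuous b T /\ coord_continuous sigma T.
Proof.
move=> beta0 mu0 [_ [Ms Ms0 hs] _] [hb _].
split; first exact: coord_continuous_lipschitz hb.
by apply: (coord_continuous_lipschitz beta0) => rho _; exists Ms => // s t x y sT tT _ _; exact: hs.
Qed.

End Fields.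

(* The chord from [x] to [X s] is tangent to the sphere up to second order, and
   it agrees with the frozen-coefficient step up to [(s - t) ^ (eta + gamma)]. *)
Lemma sphere_path_tangency (R : realType) (d : nat)
    (b sigma : R -> 'rV[R]_d -> 'rV[R]_d) (X : R -> 'rV[R]_d) (x : 'rV[R]_d)
    (t T eta gamma M Cg : R) (g : R -> R) :
  0 < eta -> eta <= gamma -> gamma <= 1 -> 1 < eta + gamma -> 0 <= M -> 0 <= Cg ->
  sphere_holder b T eta M -> sphere_holder sigma T eta M ->
  holder_bound g 0 T gamma Cg -> 0 <= t -> t <= T ->
  (forall s, t <= s <= T -> unit_sphere (X s)) -> holder_on gamma t T X ->
  (forall s, t <= s <= T -> exists J : 'rV[R]_d,
    (forall i, is_RS_integral (fun r => sigma r (X r) ord0 i) g t s (J ord0 i)) /\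
    X s = x + \row_i \int[lebesgue_measure]_(r in `[t, s]) b r (X r) ord0 i + J) ->
  exists2 C : R, 0 <= C & forall s, t <= s <= T -> s - t <= 1 ->
    `|inner x (sigma t x) * (g s - g t) + inner x (b t x) * (s - t)|
      <= C * (s - t) `^ (eta + gamma).
Proof.
move=> eta0 etag gam1 th1 M0 Cg0 hb hs hg t0 tT X1 [C0 hX] eqn.
have gam0 : 0 < gamma by exact: lt_le_trans etag.
have th0 : eta + gamma != 0 by rewrite gt_eqF// (lt_trans ltr01).
pose C := `|C0|.
have C0' : 0 <= C by exact: normr_ge0.
have {}hX u v : t <= u <= T -> t <= v <= T -> `|X u - X v| <= C * `|u - v| `^ gamma.
  move=> uT vT; apply: (le_trans (norm_le_enorm _)).
  apply: (le_trans (hX u v _ _)); rewrite ?in_itv//.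
  by rewrite ler_wpM2r ?powR_ge0// ler_norm.
pose K := M * (2 + C).
have K0 : 0 <= K by rewrite mulr_ge0// addr_ge0.
have hphi i : holder_bound (fun r => b r (X r) ord0 i) t T eta K.
  exact: (@sphere_field_path_holder _ _ _ _ _ _ _ gamma).
have hf i : holder_bound (fun r => sigma r (X r) ord0 i) t T eta K.
  exact: (@sphere_field_path_holder _ _ _ _ _ _ _ gamma).
have [L L0 HL] := RS_integral_bound eta0 gam0 th1 K0 Cg0.
have RSb i s J : t <= s <= T -> is_RS_integral (fun r => sigma r (X r) ord0 i) g t s J ->
    `|J - sigma t (X t) ord0 i * (g s - g t)| <= L * (s - t) `^ (eta + gamma).
  move=> /andP[tS sT]; apply: HL => // u v /andP[u1 u2] /andP[v1 v2].
    by apply: hf; rewrite ?u1 ?v1/= (le_trans _ sT).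
  by apply: hg; apply/andP; split; (apply: le_trans sT + apply: (le_trans t0)).
have ttT : t <= t <= T by rewrite lexx.
(* Read off the equation at [s = t]: the Young bound there is a multiple of
   [0 ^ (eta + gamma) = 0]. *)
have Xt : X t = x.
  have [J [HJ ->]] := eqn t ttT.
  apply/rowP => i; rewrite !mxE set_itv1 Rintegral_set1 addr0.
  have := RSb i t _ ttT (HJ i).
  rewrite !subrr mulr0 subr0 powR0// mulr0 normr_le0 => /eqP ->.
  by rewrite addr0.
have x1 : unit_sphere x by rewrite -Xt; exact: X1.
exists (d%:R * C ^+ 2 + d%:R * (L + K)).
  by rewrite addr_ge0// mulr_ge0 ?sqr_ge0// addr_ge0.
move=> s sT st1; have /andP[ts sT'] := sT.
have st0 : 0 <= s - t by rewrite subr_ge0.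
have [J [HJ Xs]] := eqn s sT.
pose v := euler_step b sigma g t s x.
have rem : `|X s - x - v| <= (L + K) * (s - t) `^ (eta + gamma).
  apply: rV_norm_le => [|i]; first by rewrite mulr_ge0 ?powR_ge0 ?addr_ge0.
  rewrite Xs /v /euler_step !mxE.
  have e1 := RSb i s _ sT (HJ i).
  have e2 := Rintegral_expansion eta0 K0 (hphi i) (lexx t) ts sT'.
  rewrite set_itv1 Rintegral_set1 subr0 Xt in e2; rewrite Xt in e1.
  set I := Rintegral _ _ _ in e2 *.
  have -> : x ord0 i + I + J ord0 i - x ord0 i
      - ((s - t) * b t x ord0 i + (g s - g t) * sigma t x ord0 i)
     = (J ord0 i - sigma t x ord0 i * (g s - g t)) + (I - b t x ord0 i * (s - t)) by ring.
  apply: le_trans (ler_normD _ _) _; rewrite [leRHS]mulrDl; apply: lerD => //.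
  apply: (le_trans e2); rewrite -mulrA ler_wpM2l// powRDl//.
  by rewrite ler_wpM2l ?powR_ge0// -[leLHS](powRr1 st0) powR_le_exp ?gam0// st0.
have chord : `|inner x (X s - x)| <= d%:R * C ^+ 2 * (s - t) `^ (eta + gamma).
  apply: (le_trans (unit_sphere_chord x1 (X1 s sT))); rewrite -mulrA ler_wpM2l//.
  have h := hX s t sT ttT; rewrite Xt (ger0_norm st0) in h.
  apply: (@le_trans _ _ ((C * (s - t) `^ gamma) ^+ 2)).
    by apply: lerXn2r; rewrite ?nnegrE// mulr_ge0 ?powR_ge0.
  rewrite exprMn ler_wpM2l ?sqr_ge0// expr2 powRDl// ler_wpM2r ?powR_ge0//.
  by rewrite powR_le_exp ?eta0// st0.
have -> : inner x (sigma t x) * (g s - g t) + inner x (b t x) * (s - t)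
    = inner x (X s - x) - inner x (X s - x - v).
  by rewrite (innerBr x (X s - x) v) subKr /v /euler_step innerDr !innerZr; ring.
apply: le_trans (ler_normB _ _) _; rewrite [leRHS]mulrDl; apply: lerD => //.
apply: (le_trans (inner_bound _ _)); rewrite -mulrA ler_wpM2l//.
apply: le_trans rem; rewrite ler_piMl//.
exact: unit_sphere_norm.
Qed.

Lemma ae_exists (disp : measure_display) (Omega : measurableType disp) (R : realType)
    (P : probability Omega R) (Q : Omega -> Prop) :
  (\forall w \ae P, Q w) -> exists w, Q w.
Proof.
move=> aeQ; apply: contrapT => /forallNP nQ.
have neg : P.-negligible [set: Omega].
  by move: aeQ; congr (P.-negligible _); apply/seteqP; split => // w _; exact: nQ.
have P0 : P [set: Omega] = 0%E by exact: (measure_negligible measurableT neg).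
by move: (probability_setT P); rewrite P0 => /eqP; rewrite eq_sym onee_eq0.
Qed.

Section Necessity.
Context {disp : measure_display} {Omega : measurableType disp} {R : realType}.
Context {P : probability Omega R}.
Variables (H : R) (B : R -> {RV P >-> R}).
Hypotheses (H0 : 0 < H) (H1 : H < 1) (fbm : fractional_brownian_motion H B).

(* The increments of [B] over [t, t + h] have size [h ^ H], much larger than [h]. *)
Lemma fbm_not_lipschitz_at (t T : R) : 0 <= t -> t < T ->
  \forall w \ae P, forall M : nat, ~ (forall s, t <= s <= T -> s - t <= 1 ->
    `|B s w - B t w| <= M%:R * (s - t)).
Proof.
move=> t0 tT; pose D n := dyadic_mesh t T n.
have D0 n : 0 < D n by rewrite divr_gt0 ?subr_gt0 ?exprn_gt0.
have [N _ DN] := dyadic_mesh_small (ltW tT) 0 ltr01.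
have DN1 n : (N <= n)%N -> D n <= 1.
  by move=> Nn; rewrite (le_trans _ DN)// dyadic_mesh_le// ltW.
have DT n : t <= t + D n <= T.
  rewrite lerDl ltW//= -lerBrDl /D /dyadic_mesh ler_pdivrMr ?exprn_gt0//.
  by rewrite ler_peMr ?subr_ge0 ?(ltW tT)// exprn_ege1// ler1n.
pose S (M n : nat) := [set w | `|B (t + D n) w - B t w| <= M%:R * D n].
have mS M n : measurable (S M n).
  have mf : measurable_fun setT (fun w => `|B (t + D n) w - B t w| <= M%:R * D n).
    apply: measurable_fun_ler => //; apply: measurableT_comp => //.
    exact: measurable_funB.
  by rewrite -[X in measurable X]setTI; exact: (mf measurableT [set true]).
pose E M := \bigcap_(n in [set n | (N <= n)%N]) S M n.
have mE M : measurable (E M) by apply: bigcap_measurableType.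
(* The small-ball estimate bounds each [P (S M n)] by [3 * M * D n ^ (1 - H)], which tends to 0
   because [H < 1]. *)
have PE M : P (E M) = 0%E.
  apply/eqP; rewrite eq_le measure_ge0 andbT; apply/lee_addgt0Pr => e e0.
  rewrite add0e.
  have M1 : 0 < 3 * M%:R + 1 :> R by rewrite ltr_wpDl.
  have H1' : 0 < 1 - H by rewrite subr_gt0.
  have [r r0 Hr] := powR_small H1' (divr_gt0 e0 M1).
  have [n Nn Dn] := dyadic_mesh_small (ltW tT) N r0.
  apply: (@le_trans _ _ (P (S M n))).
    by apply: le_measure; rewrite ?inE// => w; apply.
  have tD : t < t + D n by rewrite ltrDl.
  have [+ _] := fbm_increment_bounds H0 fbm t0 tD.
  move=> /(_ (M%:R * D n)); rewrite mulr_ge0 ?(ltW (D0 n))// => /(_ isT).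
  move=> /le_trans; apply; rewrite lee_fin (addrC t) addrK.
  have DE : D n = D n `^ (1 - H) * D n `^ H.
    by rewrite -powRD ?subrK ?powRr1 ?(ltW (D0 n))// (gt_eqF (D0 n)) implybT.
  rewrite {1}DE !mulrA mulfK ?gt_eqF ?powR_gt0//.
  have := Hr (D n); rewrite (ltW (D0 n)) Dn => /(_ isT).
  rewrite ler_pdivlMr// => h; apply: le_trans h.
  by rewrite mulrC ler_wpM2l ?powR_ge0// lerDl.
have aeE M : \forall w \ae P, ~ E M w.
  by exists (E M); split => // w /= /contrapT.
move/ae_foralln: aeE; apply: filterS => w nE M lip; apply: (nE M) => n /= Nn.
have tDE : t + D n - t = D n by rewrite addrAC subrr add0r.
by have := lip (t + D n) (DT n); rewrite tDE; apply; exact: DN1.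
Qed.

End Necessity.

(** Each entry of the minimum exceeds [alpha]: [beta >= alpha0], [mu > 1 - alpha0 >= 1 / 2], and
    [1 - alpha > 1 / 2], all because [alpha < alpha0 <= 1 / 2]. *)
Lemma exponent_choice (R : realType) (H beta delta mu alpha : R) :
  H < 1 -> 0 < beta -> 1 - alpha0 beta delta < mu -> 1 - H < alpha ->
  alpha < alpha0 beta delta ->
  exists eta : R, [/\ 0 < eta, eta <= 1 - alpha, eta <= beta, eta <= mu
    & 1 < eta + (1 - alpha)] /\ [/\ 0 < 1 - alpha, 1 - alpha <= 1 & 1 - alpha < H].
Proof.
move=> H1 beta0 mu_gt a1 a2.
have [al2 alb] : alpha0 beta delta <= 2^-1 /\ alpha0 beta delta <= beta.
  by rewrite /alpha0 !ge_min !lexx orbT.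
exists (Num.min beta (Num.min mu (1 - alpha))).
split; last by split; lra.
split; rewrite ?ge_min ?lexx ?orbT// ?lt_min ?beta0/=.
  by apply/andP; split; lra.
rewrite -ltrBlDr !lt_min; apply/and3P; split; lra.
Qed.

Theorem proposition3p6 (R : realType)
  (disp : measure_display) (Omega : measurableType disp)
  (P : probability Omega R) (P_complete : measure_is_complete P)
  (T : R) (T_gt0 : 0 < T) (d : nat) (d_gt0 : (0 < d)%N)
  (H : R) (H_gt : 2^-1 < H) (H_lt1 : H < 1)
  (B : R -> {RV P >-> R}) (B_fbm : fractional_brownian_motion H B)
  (b sigma : R -> 'rV[R]_d -> 'rV[R]_d)
  (b_cont : {within `[0, T] `*` setT,
               continuous (fun p : R * 'rV[R]_d => b p.1 p.2)})
  (sigma_cont : {within `[0, T] `*` setT,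
               continuous (fun p : R * 'rV[R]_d => sigma p.1 p.2)})
  (beta delta : R) (beta_gt0 : 0 < beta) (beta_le1 : beta <= 1)
  (delta_gt0 : 0 < delta) (delta_le1 : delta <= 1)
  (sigma_H1 : assumption_H1 T beta delta sigma)
  (mu : R) (mu_gt : 1 - alpha0 beta delta < mu) (mu_le1 : mu <= 1)
  (b_H2 : assumption_H2 T mu b)
  (alpha : R) (alpha_gt : 1 - H < alpha)
  (alpha_lt : alpha < alpha0 beta delta) :
  viable B T alpha b sigma unit_sphere <->
  (forall (t : R) (x : 'rV[R]_d), t \in `[0, T] -> unit_sphere x ->
     inner x (b t x) = 0 /\ inner x (sigma t x) = 0).
Proof.
have [eta [[eta0 etag etab etam th1] [gam0 gam1 gamH]]] :=
  exponent_choice H_lt1 beta_gt0 mu_gt alpha_gt alpha_lt.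
set gamma := 1 - alpha in etag th1 gam0 gam1 gamH.
have H0 : 0 < H by exact: lt_trans gamH.
have mu0 : 0 < mu by exact: lt_le_trans etam.
have [M M0 [hb hs]] := assumptions_sphere_holder eta0 etab etam sigma_H1 b_H2 T_gt0.
have aeB := fbm_holder H0 B_fbm T_gt0 gam0 gam1 gamH.
split => [viab t x | tang t x].
  (* Paths started at [T] carry no information, so the final time is reached through the time
     regularity of the fields at a fixed point of the sphere. *)
  suff interior s y : 0 <= s -> s < T -> unit_sphere y ->
      inner y (b s y) = 0 /\ inner y (sigma s y) = 0.
    rewrite in_itv/= => /andP[t0]; rewrite le_eqVlt => /predU1P[->|tT] x1; last exact: interior.
    have limit F : sphere_holder F T eta M ->
        (forall s, 0 <= s -> s < T -> inner x (F s x) = 0) -> inner x (F T x) = 0.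
      move=> [hF _] F0; apply/eqP; rewrite -normr_le0.
      apply: (@le_of_le_add_mul _ _ _ (d%:R * M)); first by rewrite mulr_ge0.
      move=> e e0; have [r r0 Hr] := powR_small eta0 e0.
      pose h := Num.min r (Num.min 1 T).
      have h0 : 0 < h by rewrite !lt_min r0 ltr01 T_gt0.
      have [hr h1 hT] : [/\ h <= r, h <= 1 & h <= T].
        by rewrite /h !ge_min !lexx !orbT.
      have Th0 : 0 <= T - h by rewrite subr_ge0.
      have ThT : T - h < T by rewrite gtrBl.
      have -> : inner x (F T x) = inner x (F T x - F (T - h) x).
        by rewrite innerBr (F0 _ Th0 ThT) subr0.
      have TE : T - (T - h) = h by rewrite opprB addrC subrK.
      rewrite add0r; apply: (le_trans (inner_bound _ _)).
      rewrite -mulrA ler_wpM2l//.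
      apply: (@le_trans _ _ `|F T x - F (T - h) x|).
        by rewrite ler_piMl// unit_sphere_norm.
      apply: (le_trans (hF _ _ _ _ _ _ _ x1 x1)).
      - by rewrite Th0 ltW.
      - by rewrite lexx ltW.
      - by rewrite TE gtr0_norm.
      by rewrite subrr normr0 addr0 TE (gtr0_norm h0) ler_wpM2l// Hr// (ltW h0).
    by split; apply: limit => // s s0 sT; have [] := interior s x s0 sT x1.
  move=> s0 sT y1.
  have sin : s \in `[0, T] by rewrite in_itv/= s0 ltW.
  have [X [_ hX eqX] X1] := viab s y sin y1.
  pose A := inner y (sigma s y); pose Dr := inner y (b s y).
  have bound : \forall w \ae P, exists2 C : R, 0 <= C &
      forall r, s <= r <= T -> r - s <= 1 ->
        `|A * (B r w - B s w) + Dr * (r - s)| <= C * (r - s) `^ (eta + gamma).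
    have aeX : \forall w \ae P, (forall r, r \in `[s, T] -> unit_sphere (X r w)) /\
        holder_on gamma s T (X^~ w).
      by move: X1 hX; apply: filterS2 => w; split.
    move: aeB aeX eqX; apply: filterS3 => w [Cg Cg0 hg] [X1w hXw] eqw.
    apply: (sphere_path_tangency eta0 etag gam1 th1 M0 Cg0 hb hs hg s0 (ltW sT) _ hXw).
      by move=> r rT; apply: X1w; rewrite in_itv.
    by move=> r rT; apply: eqw; rewrite in_itv.
  (* [A] and [Dr] are deterministic, so a single path that satisfies the bound and is not Lipschitz
     at [s] is enough. *)
  have A0 : A = 0.
    apply/eqP; apply: contrapT => /negP A0.
    have [w [nlip [C C0 HC]]] : exists w,
        (forall N : nat, ~ (forall r, s <= r <= T -> r - s <= 1 ->
           `|B r w - B s w| <= N%:R * (r - s))) /\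
        exists2 C : R, 0 <= C & forall r, s <= r <= T -> r - s <= 1 ->
          `|A * (B r w - B s w) + Dr * (r - s)| <= C * (r - s) `^ (eta + gamma).
      apply: (@ae_exists _ _ _ P); have := fbm_not_lipschitz_at H0 H_lt1 B_fbm s0 sT.
      by move: bound; apply: filterS2 => w bw lw; split.
    have nA : 0 < `|A| by rewrite normr_gt0.
    (* If [A] were nonzero, [N] would be a Lipschitz constant of that path at [s]: the exponent
       [eta + gamma] exceeds 1, so the error is also at most [C * (r - s)]. *)
    pose N := (Num.truncn ((C + `|Dr|) / `|A|)).+1.
    apply: (nlip N) => r rT r1; have /andP[sr _] := rT.
    have rs0 : 0 <= r - s by rewrite subr_ge0.
    have h1 := HC r rT r1.
    have h2 : (r - s) `^ (eta + gamma) <= r - s.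
      by rewrite -[leRHS](powRr1 rs0) powR_le_exp ?rs0// ltr01 ltW.
    have h3 : `|A| * `|B r w - B s w| <= (C + `|Dr|) * (r - s).
      rewrite -normrM -[A * _](addrK (Dr * (r - s))).
      apply: le_trans (ler_normB _ _) _; rewrite normrM (ger0_norm rs0) mulrDl lerD2r.
      by apply: (le_trans h1); rewrite ler_wpM2l.
    rewrite -(ler_pM2l nA); apply: (le_trans h3); rewrite mulrA ler_wpM2r//.
    by rewrite mulrC -ler_pdivrMr// ltW// truncnS_gt.
  split; last exact: A0.
  (* With [A = 0] the bound reads [|Dr| * h <= C * h ^ (eta + gamma)]; it is divided by [h] and [h]
     tends to 0. *)
  have [w [C C0 HC]] := ae_exists bound.
  apply/eqP; rewrite -normr_le0 -/Dr.
  apply: (@le_of_le_add_mul _ _ _ C) => // e e0.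
  have th0 : 0 < eta + gamma - 1 by rewrite subr_gt0.
  have [r r0 Hr] := powR_small th0 e0.
  pose h := Num.min r (Num.min 1 (T - s)).
  have h0 : 0 < h by rewrite !lt_min r0 ltr01 subr_gt0.
  have [hr h1 hT] : [/\ h <= r, h <= 1 & h <= T - s].
    by rewrite /h !ge_min !lexx !orbT.
  have shT : s <= s + h <= T by rewrite lerDl (ltW h0)/= -lerBrDl.
  have shE : s + h - s = h by rewrite addrAC subrr add0r.
  have := HC (s + h) shT; rewrite shE A0 mul0r add0r => /(_ h1).
  rewrite normrM (gtr0_norm h0) -(mulr_powRB1 (ltW h0) (lt_trans ltr01 th1)).
  rewrite (mulrC h) mulrA ler_pM2r// => /le_trans; apply.
  by rewrite add0r ler_wpM2l// Hr// (ltW h0).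
rewrite in_itv/= => /andP[t0 tT] x1.
have [cb cs] := assumptions_coord_continuous beta_gt0 mu0 sigma_H1 b_H2.
have tb (s : R) y : 0 <= s <= T -> unit_sphere y -> inner y (b s y) = 0.
  by move=> sT y1; have [] := tang s y _ y1; rewrite ?in_itv.
have ts (s : R) y : 0 <= s <= T -> unit_sphere y -> inner y (sigma s y) = 0.
  by move=> sT y1; have [] := tang s y _ y1; rewrite ?in_itv.
have mB s : measurable_fun setT (B s) by exact: measurable_funPT.
have [X mX HX] := sphere_process eta0 etag gam1 th1 M0 hb hs cb cs tb ts mB t0 tT x1.
exists X.
  split.
  - by move=> s i _; exact: mX.
  - by apply: filterS aeB => w /HX[].
  - by apply: filterS aeB => w /HX[_ _ eqX] s; rewrite in_itv/= => sT; exact: eqX.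
by apply: filterS aeB => w /HX[X1 _ _] s; rewrite in_itv/= => sT; exact: X1.
Qed.
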